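(* Consider the stochastic wave equation on the sphere $\partial_{tt}u(t)-\Delta_{\mathbb S^2}u(t)=\dot L(t)$ with initial values $(u(0),\partial_t u(0))=(v_1,v_2)\in[L^2(\mathbb S^2,\mathbb R)]^2$. Assume that the expected initial energy satisfies $\mathbb E[\mathcal E(0)]<\infty$ and that the mean-zero $Q$-Lévy process $L$ is trace-class. Then the mild solution satisfies the trace formula for the energy $$\mathbb E[\mathcal E(t)]=\mathbb E[\mathcal E(0)]+\frac t2\operatorname{Tr}(Q)$$ for every $t\ge 0$, where $\mathcal E(t)=\frac12\left(\|\partial_t u(t)\|^2+\|(-\Delta_{\mathbb S^2})^{1/2}u(t)\|^2\right)$.
   Context: $\mathbb S^2\subset\mathbb R^3$ is the unit sphere with its surface measure, $L^2(\mathbb S^2)=L^2(\mathbb S^2,\mathbb R)$ with inner product $\langle\cdot,\cdot\rangle$ and norm $\|\cdot\|$, and $\Delta_{\mathbb S^2}$ is the Laplace--Beltrami operator. The real spherical harmonics $(Y_{\ell,m})_{\ell\ge0,\,-\ell\le m\le\ell}$ form an orthonormal basis of $L^2(\mathbb S^2)$ with $-\Delta_{\mathbb S^2}Y_{\ell,m}=\lambda_\ell Y_{\ell,m}$, $\lambda_\ell=\ell(\ell+1)$. Functions of $-\Delta_{\mathbb S^2}$ are defined by functional calculus in this basis; on the $\ell=0$ mode $(-\Delta_{\mathbb S^2})^{-1/2}\sin(t(-\Delta_{\mathbb S^2})^{1/2})$ is understood as multiplication by $t$. $(\Omega,\mathcal F,(\mathcal F_t)_{t\ge0},\mathbb P)$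 is a complete filtered probability space; the initial values $v_1,v_2$ are $\mathcal F_0$-measurable (possibly random). $L$ is a square-integrable $L^2(\mathbb S^2)$-valued Lévy process with respect to $(\mathcal F_t)$ (adapted, $L(0)=0$, stochastically continuous, stationary increments, $L(t)-L(s)$ independent of $\mathcal F_s$ for $s\le t$), with $\mathbb E[L(t)]=0$ and covariance operator $Q$ (symmetric, positive semi-definite): $\mathbb E[\langle L(t),f\rangle\langle L(t),g\rangle]=t\langle Qf,g\rangle$. ''Trace-class'' means $\operatorname{Tr}(Q)=\sum_{\ell,m}\langle QY_{\ell,m},Y_{\ell,m}\rangle<\infty$. The mild solution $(u_1,u_2)=(u,\partial_tu)$ is, writing $\Lambda=(-\Delta_{\mathbb S^2})^{1/2}$, $$u_1(t)=\cos(t\Lambda)v_1+\Lambda^{-1}\sin(t\Lambda)v_2+\int_0^t\Lambda^{-1}\sin((t-s)\Lambda)\,dL(s),$$ $$u_2(t)=-\Lambda\sin(t\Lambda)v_1+\cos(t\Lambda)v_2+\int_0^t\cos((t-s)\Lambda)\,dL(s).$$ *)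

(* Defs.v *)
From HB Require Import structures.
From mathcomp Require Import all_boot all_order all_algebra.
From mathcomp Require Import all_classical all_reals all_analysis.
From mathcomp Require Import measurable_realfun.

Set Implicit Arguments.
Unset Strict Implicit.
Unset Printing Implicit Defensive.
Import Order.TTheory GRing.Theory Num.Theory.
Import numFieldNormedType.Exports.
Local Open Scope classical_set_scope.
Local Open Scope ring_scope.

(** * The unit sphere and its surface measure *)

Section sphere.
Context (R : realType).

Record sphere : Type := Sphere {
  sphere_val : 'rV[R]_3 ;
  _ : \sum_(i < 3) sphere_val ord0 i ^+ 2 == 1 }.

HB.instance Definition _ := [isSub for sphere_val].
HB.instance Definition _ := [Choice of sphere by <:].

Definition vec3 (a b c : R) : 'rV[R]_3 := \row_(i < 3) [:: a; b; c]`_i.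

Lemma sph_param_subproof (x : R * R) : \sum_(i < 3)
  (vec3 (sin x.1 * cos x.2) (sin x.1 * sin x.2) (cos x.1)) ord0 i ^+ 2 == 1.
Proof.
rewrite !big_ord_recl big_ord0 !mxE /= addr0 !exprMn addrA -mulrDr.
by rewrite cos2Dsin2 mulr1 addrC cos2Dsin2.
Qed.

(* Spherical coordinates: x.1 is the colatitude, x.2 the longitude. *)
Definition sph_param (x : R * R) : sphere :=
  Sphere (sph_param_subproof x).

HB.instance Definition _ := isPointed.Build sphere (sph_param (0, 0)).

(* The Borel sigma-algebra of the sphere, as the trace of the one of R^3. *)
Definition sphere_coord (i : 'I_3) (p : sphere) : R := sphere_val p ord0 i.

Let sphere_measurable : set (set sphere) := g_sigma_preimage sphere_coord.

Let sphere_set0 : sphere_measurable set0.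
Proof. exact: sigma_algebra0. Qed.

Let sphere_setC A : sphere_measurable A -> sphere_measurable (~` A).
Proof. exact: sigma_algebraC. Qed.

Let sphere_bigcup (F : (set sphere)^nat) :
  (forall i, sphere_measurable (F i)) -> sphere_measurable (\bigcup_i F i).
Proof. exact: sigma_algebra_bigcup. Qed.

HB.instance Definition _ := @isMeasurable.Build default_measure_display
  sphere sphere_measurable sphere_set0 sphere_setC sphere_bigcup.

Lemma measurable_sph_param : measurable_fun [set: R * R] sph_param.
Proof.
have msin : measurable_fun [set: R] (@sin R).
  by apply: continuous_measurable_fun; exact: continuous_sin.
have mcos : measurable_fun [set: R] (@cos R).
  by apply: continuous_measurable_fun; exact: continuous_cos.
have m1 (f : R -> R) : measurable_fun [set: R] f ->
    measurable_fun [set: R * R] (fun x => f x.1).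
  by move=> mf; exact: measurableT_comp.
have m2 (f : R -> R) : measurable_fun [set: R] f ->
    measurable_fun [set: R * R] (fun x => f x.2).
  by move=> mf; exact: measurableT_comp.
apply: (measurability (\big[setU/set0]_(i < 3)
  preimage_set_system setT (sphere_coord i) measurable)); first by [].
move=> _ [B + <-]; rewrite setTI -bigcup_mkord_ord => -[i i3 [C mC <-]].
rewrite setTI -comp_preimage -[X in measurable X]setTI.
suff : measurable_fun setT (sphere_coord (inord i) \o sph_param).
  by move=> /(_ measurableT); exact.
rewrite /comp /sphere_coord /=.
case: i i3 => [|[|[|//]]] _; under eq_fun do rewrite mxE inordK//=.
- by apply: measurable_funM; [exact: m1|exact: m2].
- by apply: measurable_funM; [exact: m1|exact: m2].
- exact: m1.
Qed.

Definition sph_domain : set (R * R) := `[0, pi]%classic `*` `[0, 2 * pi]%classic.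

(* Surface area, with area element [sin theta dtheta dphi]. *)
Definition surface_area (A : set sphere) : \bar R :=
  \int[(@lebesgue_measure R \x @lebesgue_measure R)%E]_(x in
     sph_domain `&` sph_param @^-1` A) (sin x.1)%:E.

Let mpre (A : set sphere) : measurable A ->
  measurable (sph_domain `&` sph_param @^-1` A).
Proof.
move=> mA; apply: measurableI.
  by apply: measurableX; exact: measurable_itv.
by rewrite -[X in measurable X]setTI; exact: measurable_sph_param.
Qed.

Let area0 : surface_area set0 = 0%E.
Proof. by rewrite /surface_area preimage_set0 setI0 integral_set0. Qed.

Let sin_dom_ge0 (x : R * R) : sph_domain x -> (0 <= (sin x.1)%:E)%E.
Proof. by move=> [/= + _]; rewrite in_itv/= lee_fin => /sin_ge0_pi. Qed.

Let area_ge0 A : (0 <= surface_area A)%E.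
Proof. by apply: integral_ge0 => x [/sin_dom_ge0]. Qed.

Let area_sigma_additive : semi_sigma_additive surface_area.
Proof.
move=> F mF tF mUF; rewrite /surface_area preimage_bigcup setI_bigcupr.
rewrite ge0_integral_bigcup//=.
- apply: is_cvg_ereal_nneg_natsum_cond => n _ _; exact: area_ge0.
- by move=> n; exact: mpre.
- apply/measurable_EFinP/measurable_funTS; apply: measurableT_comp => //.
  by apply: continuous_measurable_fun; exact: continuous_sin.
- by move=> x [n _ [/sin_dom_ge0]].
- apply/trivIsetP => i j _ _ ij; rewrite setIACA setIid -preimage_setI.
  by move/trivIsetP : tF => /(_ _ _ I I ij) ->; rewrite preimage_set0 setI0.
Qed.

HB.instance Definition _ := isMeasure.Build _ _ _
  surface_area area0 area_ge0 area_sigma_additive.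

End sphere.

(** * The real Hilbert space L^2 of the sphere *)

(* An element of [L2S R] is a square-integrable representative; equality in
   L^2 is almost-everywhere equality, written [f = g %[ae @surface_area R]]. *)
Definition L2S (R : realType) := LfunType (@surface_area R) (lee1n 2).

Section L2S_theory.
Context (R : realType).
Notation H := (L2S R).
Implicit Types (f g h : H) (T : H -> H).

Definition inner f g : R := \int[@surface_area R]_x (f x * g x).

Definition hnorm f : R := Num.sqrt (inner f f).

(* Borel sets for the L^2 seminorm; they are saturated for a.e. equality. *)
Definition hopen (U : set H) : Prop :=
  forall f, U f -> exists2 e : R, 0 < e & forall g, hnorm (g - f) < e -> U g.

Definition hborel : set (set H) := <<s hopen >>.

Definition bounded_linear T : Prop :=
  (forall (a : R) f g, T (a *: f + g) = a *: T f + T g %[ae @surface_area R]) /\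
  (exists C : R, forall f, hnorm (T f) <= C * hnorm f).

Definition symmetric_op T : Prop := forall f g, inner (T f) g = inner f (T g).

Definition positive_op T : Prop := forall f, 0 <= inner (T f) f.

Definition op_sqrt (Q S : H -> H) : Prop :=
  [/\ bounded_linear S, symmetric_op S, positive_op S &
      forall f, S (S f) = Q f %[ae @surface_area R]].

End L2S_theory.

(** * Laplace-Beltrami operator and spherical harmonics *)

Section laplacian.
Context (R : realType).
Implicit Types f : sphere R -> R.

(* Extension of [f] to R^3 minus the origin, constant along rays; the value
   at the origin is irrelevant. *)
Definition radial_ext f (x : 'rV[R]_3) : R :=
  f (insubd (sph_param (0, 0))
       ((Num.sqrt (\sum_(i < 3) x ord0 i ^+ 2))^-1 *: x)).

Definition partial3 (i : 'I_3) (F : 'rV[R]_3 -> R) : 'rV[R]_3 -> R :=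
  'D_(delta_mx ord0 i) F.

Definition smooth_on_sphere f : Prop :=
  forall (s : seq 'I_3) (x : 'rV[R]_3), x != 0 ->
    {for x, continuous (foldr partial3 (radial_ext f) s)} /\
    forall i, derivable (foldr partial3 (radial_ext f) s) x (delta_mx ord0 i).

(* The radial extension has no radial derivatives, so its Euclidean Laplacian
   on the unit sphere is purely tangential. *)
Definition laplace_beltrami f (p : sphere R) : R :=
  \sum_(i < 3) partial3 i (partial3 i (radial_ext f)) (val p).

End laplacian.

(* Sum over the orders m = -l, ..., l. *)
Definition sum_order (V : nmodType) (l : nat) (F : int -> V) : V :=
  \sum_(k < l.*2.+1) F (k%:Z - l%:Z).

Section spectral.
Context (R : realType).
Notation H := (L2S R).
Variable Y : nat -> int -> H.

Definition eigval (l : nat) : R := (l * l.+1)%:R.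

Definition harmonic_series (c : nat -> int -> R) (n : nat) : H :=
  \sum_(l < n) sum_order l (fun m => c l m *: Y l m).

Definition converges_to (u : nat -> H) (w : H) : Prop :=
  hnorm (u n - w) @[n --> \oo] --> (0 : R).

(* Values of [Y l m] with |m| > l are never used. *)
Record real_spherical_harmonics : Prop := {
  sh_smooth : forall l (m : int), `|m| <= l%:Z -> smooth_on_sphere (Y l m) ;
  sh_eigen : forall l (m : int), `|m| <= l%:Z -> forall p,
    - laplace_beltrami (Y l m) p = eigval l * Y l m p ;
  sh_orthonormal : forall l (m : int) l' (m' : int),
    `|m| <= l%:Z -> `|m'| <= l'%:Z ->
    inner (Y l m) (Y l' m') = ((l == l') && (m == m'))%:R ;
  sh_complete : forall f : H,
    converges_to (harmonic_series (fun l m => inner f (Y l m))) f }.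

(* Functional calculus: [fcalc phi] is the operator phi(-Delta), and
   [fcalc_dom phi] its domain; outside the domain the value is junk. *)
Definition is_fcalc (phi : R -> R) (f w : H) : Prop :=
  converges_to
    (harmonic_series (fun l m => phi (eigval l) * inner f (Y l m))) w.

Definition fcalc_dom (phi : R -> R) : set H :=
  [set f | exists w, is_fcalc phi f w].

Definition fcalc (phi : R -> R) (f : H) : H := xget 0 [set w | is_fcalc phi f w].

(* Multipliers, as functions of the eigenvalue x of -Delta, of Lambda,
   cos(t Lambda), Lambda^{-1} sin(t Lambda) and -Lambda sin(t Lambda), where
   Lambda = (-Delta)^{1/2}. *)
Definition Lambda_m (x : R) : R := Num.sqrt x.
Definition cos_m (t x : R) : R := cos (t * Num.sqrt x).
Definition sinc_m (t x : R) : R :=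
  if x == 0 then t else sin (t * Num.sqrt x) / Num.sqrt x.
Definition msin_m (t x : R) : R := - Num.sqrt x * sin (t * Num.sqrt x).

Definition trace (Q : H -> H) : \bar R :=
  (\sum_(0 <= l <oo) (sum_order l (fun m => inner (Q (Y l m)) (Y l m)))%:E)%E.

(* Squared Hilbert-Schmidt norm. *)
Definition hs_norm2 (T : H -> H) : \bar R :=
  (\sum_(0 <= l <oo) (sum_order l (fun m => hnorm (T (Y l m)) ^+ 2))%:E)%E.

(* Energy of the pair (position, velocity), infinite when the position is not
   in the domain of the square root of -Delta. *)
Definition energy (u1 u2 : H) : \bar R :=
  if `[< fcalc_dom Lambda_m u1 >] then
    (2^-1 * (hnorm u2 ^+ 2 + hnorm (fcalc Lambda_m u1) ^+ 2))%:E
  else +oo%E.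

End spectral.

(** * Levy processes and the stochastic integral *)

Section stochastic.
Context (R : realType) (d : measure_display) (Omega : measurableType d).
Variable P : probability Omega R.
Notation H := (L2S R).

Definition complete_filtration (F : R -> set (set Omega)) : Prop :=
  [/\ forall t, 0 <= t -> sigma_algebra setT (F t) /\ F t `<=` measurable,
      forall s t, 0 <= s -> s <= t -> F s `<=` F t &
      P.-negligible `<=` F 0].

Definition hmeasurable (G : set (set Omega)) (X : Omega -> H) : Prop :=
  forall B, hborel B -> G (X @^-1` B).

Record levy_process (F : R -> set (set Omega)) (L : R -> Omega -> H) : Prop := {
  levy_adapted : forall t, 0 <= t -> hmeasurable (F t) (L t) ;
  levy_start : {ae P, forall w, L 0 w = 0 %[ae @surface_area R]} ;
  levy_stoch_cont : forall t e : R, 0 <= t -> 0 < e ->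
    P [set w | e < hnorm (L s w - L t w)]
      @[s --> within [set s | 0 <= s] (nbhs t)] --> 0%E ;
  levy_stationary : forall s t : R, 0 <= s -> s <= t -> forall B, hborel B ->
    P [set w | B (L t w - L s w)] = P [set w | B (L (t - s) w)] ;
  levy_indep : forall s t : R, 0 <= s -> s <= t -> forall A B, F s A -> hborel B ->
    P (A `&` [set w | B (L t w - L s w)]) =
    (P A * P [set w | B (L t w - L s w)%R])%E }.

(* Expectations of H-valued variables are taken weakly: E[X] = 0 means
   E<X, f> = 0 for all f, which for square-integrable X is the Bochner mean. *)
Record Q_levy_process (F : R -> set (set Omega)) (Q : H -> H)
    (L : R -> Omega -> H) : Prop := {
  Q_bounded : bounded_linear Q ;
  Q_symmetric : symmetric_op Q ;
  Q_positive : positive_op Q ;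
  Q_levy : levy_process F L ;
  Q_square_integrable : forall t, 0 <= t ->
    (\int[P]_w (hnorm (L t w) ^+ 2)%:E < +oo)%E ;
  Q_mean0 : forall t, 0 <= t -> forall f : H,
    (\int[P]_w (inner (L t w) f)%:E = 0)%E ;
  Q_covariance : forall t, 0 <= t -> forall f g : H,
    (\int[P]_w (inner (L t w) f * inner (L t w) g)%:E =
     (t * inner (Q f) g)%:E)%E }.

(* Deterministic operator-valued step function, equal to [step_op k] on
   ]step_time k, step_time k.+1] for k < step_size. *)
Record step_process := StepProcess {
  step_size : nat ;
  step_time : nat -> R ;
  step_op : nat -> H -> H }.

Definition step_wf (t : R) (p : step_process) : Prop :=
  [/\ step_time p 0 = 0, step_time p (step_size p) = t,
      {homo step_time p : i j / (i <= j)%N >-> i <= j} &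
      forall k, bounded_linear (step_op p k)].

Definition step_eval (p : step_process) (s : R) (f : H) : H :=
  \sum_(k < step_size p)
    (\1_(`]step_time p k, step_time p k.+1]%classic : set R) s : R)
      *: step_op p k f.

Definition step_integral (p : step_process) (L : R -> Omega -> H) (w : Omega) : H :=
  \sum_(k < step_size p)
    step_op p k (L (step_time p k.+1) w - L (step_time p k) w).

(* [I] is the stochastic integral of the deterministic integrand [Phi] over
   [0, t] against a Levy process with covariance Q: by the Ito isometry, the
   limit in L^2(Omega; H) of step integrals whose integrands converge to Phi in
   L^2(0, t) for the Hilbert-Schmidt norm of Phi Q^{1/2}. *)
Definition is_stoch_integral (Y : nat -> int -> H) (Q : H -> H)
    (L : R -> Omega -> H) (t : R) (Phi : R -> H -> H) (I : Omega -> H) : Prop :=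
  hmeasurable measurable I /\
  exists S : H -> H, op_sqrt Q S /\
  exists p : nat -> step_process,
  [/\ forall n, step_wf t (p n),
      (\int[@lebesgue_measure R]_(s in `[0%R, t])
         hs_norm2 Y (fun f => step_eval (p n) s (S f) - Phi s (S f))%R)%E
        @[n --> \oo] --> 0%E &
      (\int[P]_w (hnorm (step_integral (p n) L w - I w)%R ^+ 2)%:E)%E
        @[n --> \oo] --> 0%E].

Definition mild_solution (Y : nat -> int -> H) (Q : H -> H)
    (L : R -> Omega -> H) (v1 v2 : Omega -> H) (u1 u2 : R -> Omega -> H) : Prop :=
  forall t, 0 <= t -> exists I1 I2 : Omega -> H,
  [/\ is_stoch_integral Y Q L t (fun s => fcalc Y (sinc_m (t - s))) I1,
      is_stoch_integral Y Q L t (fun s => fcalc Y (cos_m (t - s))) I2,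
      {ae P, forall w, u1 t w =
         fcalc Y (cos_m t) (v1 w) + fcalc Y (sinc_m t) (v2 w) + I1 w
           %[ae @surface_area R]} &
      {ae P, forall w, u2 t w =
         fcalc Y (msin_m t) (v1 w) + fcalc Y (cos_m t) (v2 w) + I2 w
           %[ae @surface_area R]}].

End stochastic.

(* Main.v *)
Require Import Defs.
From mathcomp Require Import all_boot all_order all_algebra.
From mathcomp Require Import all_classical all_reals all_analysis.
From mathcomp Require Import measurable_realfun zify ring lra.

Set Implicit Arguments.
Unset Strict Implicit.
Unset Printing Implicit Defensive.
Import Order.TTheory GRing.Theory Num.Theory.
Import numFieldNormedType.Exports.
Local Open Scope classical_set_scope.
Local Open Scope ring_scope.

(** In the basis of spherical harmonics the wave equation decouples into scalar
    oscillators, and the energy is a sum over the modes of one half of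
    (Lambda <u1, Y>)^2 + <u2, Y>^2.  This holds as an identity in [0, +oo]
    ([energy_series]): by Riesz-Fischer ([riesz_fischer], which rests on the
    completeness of L^2, [sqint_complete]) the series diverges exactly when the
    position is outside the domain of Lambda.  By monotone convergence
    ([integral_modal_series]) it is enough to follow one mode in expectation.

    In a mode with eigenvalue x and harmonic y, the deterministic flow rotates
    the pair (sqrt x <u1, y>, <u2, y>) and preserves the sum of squares
    ([wave_rotation]).  The noise adds the coefficient <I, y> of a stochastic
    integral to an F_0-measurable random variable X, and [ito_mode] says
    E(X + <I, y>)^2 = E X^2 + <Q y, y> * integral over [0, t] of phi_s(x)^2.
    For position and velocity the kernels are sin and cos of the same phase, so
    their squares sum to one and the mode gains t <Q y, y> ([mode_energy]).
    Summing over all modes and halving produces (t / 2) Tr Q.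

    Keeping X inside the isometry spares a separate treatment of the cross
    terms: for step integrands the claim is Pythagoras for centred independent
    increments ([sqint_step_sum]), and second moments pass to limits in L^2
    ([cvg_sqint]).  On the integrand side, a step operator T only matters
    through the vector h with <T f, y> = <f, h> ([adjoint_exists]), and the
    Hilbert-Schmidt distance of the integrands dominates the distance of S h
    to phi_s(x) S y, where S is the square root of Q ([hs_norm2_lower]).

    The hypothesis bounds the energy of u(0), whereas the computation starts
    from (v1, v2).  The isometry on the interval [0, 0] shows that the
    stochastic integrals vanish at time 0, so both energies agree almost surely
    ([energy_at0]).  The finite expectation puts v1 in the domain of Lambda
    almost surely, without which the term - Lambda sin(t Lambda) v1 of the
    velocity would be meaningless. *)

(** * Square integrals and limits in L^2 *)

Section square_integrals.
Context d (T : measurableType d) (R : realType) (mu : {measure set T -> \bar R}).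

(** The integral of a nonnegative function is a supremum over simple functions
    below it, so it is monotone without measurability.  This is what lets
    Hilbert-Schmidt norms and norms of step integrals be compared with
    coefficients although their own measurability is never established. *)
Lemma le_integral_nonmeasurable (D : set T) (f g : T -> \bar R) :
  (forall x, D x -> (0 <= f x)%E) -> (forall x, D x -> (f x <= g x)%E) ->
  (\int[mu]_(x in D) f x <= \int[mu]_(x in D) g x)%E.
Proof.
move=> f0 fg; have g0 x : D x -> (0 <= g x)%E.
  by move=> Dx; exact: le_trans (f0 _ Dx) (fg _ Dx).
rewrite !ge0_integralE//; apply: le_ereal_sup => _ [h hf <-].
exists h => // x; apply: le_trans (hf x) _; rewrite /patch.
by case: ifPn => // /set_mem /fg.
Qed.

Definition sqint (D : set T) (f : T -> R) : \bar R :=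
  (\int[mu]_(x in D) (f x ^+ 2)%:E)%E.

Lemma sqint_ge0 D f : (0 <= sqint D f)%E.
Proof. by apply: integral_ge0 => x _; rewrite lee_fin sqr_ge0. Qed.

Lemma measurable_sqr (D : set T) (f : T -> R) : measurable_fun D f ->
  measurable_fun D (fun x => (f x ^+ 2)%:E).
Proof. by move=> mf; apply/measurable_EFinP; exact: measurable_funX. Qed.

Lemma Lfun2P (f : T -> R) :
  f \in Lfun mu 2%:E <-> measurable_fun setT f /\ (sqint setT f < +oo)%E.
Proof.
split=> [f2|[mf f2]].
  have /integrableP[mf fi] := Lfun2_integrable_sqr f2.
  split; first by move: f2; rewrite inE => /andP[]; rewrite inE.
  rewrite (le_lt_trans _ fi)// /sqint; apply: le_integral_nonmeasurable => x _.
    by rewrite lee_fin sqr_ge0.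
  by rewrite /= lee_fin ler_norm.
rewrite inE; apply/andP; split; rewrite inE//=.
rewrite /finite_norm unlock poweR_lty//.
rewrite (le_lt_trans _ f2)// /sqint; apply: le_integral_nonmeasurable => x _.
  by rewrite lee_fin powR_ge0.
by rewrite /= powR_mulrn// real_normK ?num_real.
Qed.

Lemma sqintZ (D : set T) (mD : measurable D) (c : R) f : measurable_fun D f ->
  sqint D (fun x => c * f x) = ((c ^+ 2)%:E * sqint D f)%E.
Proof.
move=> mf; rewrite /sqint; under eq_integral do rewrite exprMn EFinM.
rewrite ge0_integralZl_EFin ?sqr_ge0//; last exact: measurable_sqr.
by move=> x _; rewrite lee_fin sqr_ge0.
Qed.

(** Young's inequality: e f^2 <= e (1 + e) g^2 + (1 + e) (f - g)^2 because the
    difference is the square of e g - (f - g). *)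
Lemma sqint_perturb (D : set T) (mD : measurable D) (e : R) f g :
  0 < e -> measurable_fun D f -> measurable_fun D g ->
  (sqint D f <= (1 + e)%:E * sqint D g +
    (1 + e^-1)%:E * sqint D (fun x => f x - g x)%R)%E.
Proof.
move=> e0 mf mg; have mfg := measurable_funB mf mg.
rewrite /sqint -!ge0_integralZl_EFin//; last 6 first.
- by move=> x _; rewrite lee_fin sqr_ge0.
- exact: measurable_sqr.
- by rewrite addr_ge0 ?invr_ge0// ltW.
- by move=> x _; rewrite lee_fin sqr_ge0.
- exact: measurable_sqr.
- by rewrite addr_ge0// ltW.
rewrite -ge0_integralD//; last 4 first.
- by move=> x _; rewrite -EFinM lee_fin mulr_ge0 ?sqr_ge0// addr_ge0// ltW.
- by apply: measurable_funeM; exact: measurable_sqr.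
- move=> x _; rewrite -EFinM lee_fin mulr_ge0 ?sqr_ge0//.
  by rewrite addr_ge0// ?invr_ge0 ltW.
- by apply: measurable_funeM; exact: measurable_sqr.
apply: le_integral_nonmeasurable => x _; first by rewrite lee_fin sqr_ge0.
rewrite -!EFinM -EFinD lee_fin -subr_ge0.
set a := f x; set b := g x.
rewrite (_ : _ - _ = e^-1 * (e * b - (a - b)) ^+ 2); last first.
  by field; rewrite gt_eqF.
by rewrite mulr_ge0 ?sqr_ge0// invr_ge0 ltW.
Qed.

Lemma sqint_subC D f g :
  sqint D (fun x => f x - g x) = sqint D (fun x => g x - f x).
Proof. by apply: eq_integral => x _; rewrite -sqrrN opprB. Qed.

(** Taking [sqint_perturb] in both directions with a small parameter traps
    the square integrals of u n around that of f; with parameter 1 it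
    first shows that f is square integrable. *)
Lemma cvg_sqint (D : set T) (mD : measurable D) (u : nat -> T -> R) (f : T -> R) :
  (forall n, measurable_fun D (u n)) -> measurable_fun D f ->
  (forall n, sqint D (u n) < +oo)%E ->
  sqint D (fun x => u n x - f x) @[n --> \oo] --> 0%E ->
  sqint D (u n) @[n --> \oo] --> sqint D f.
Proof.
move=> mu_ mf uoo /fine_cvgP [Dfin D0].
have ffin : sqint D f \is a fin_num.
  have [N _ NP] := Dfin; rewrite ge0_fin_numE ?sqint_ge0//.
  have := sqint_perturb mD ltr01 mf (mu_ N).
  move=> /le_lt_trans; apply; rewrite lte_add_pinfty ?lte_mul_pinfty//.
  by rewrite sqint_subC -ge0_fin_numE ?sqint_ge0// NP/=.
move: (sqint_ge0 D f); rewrite -(fineK ffin) lee_fin; set a := fine _ => a0.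
apply/fine_cvgP.
have lebound (e : R) : 0 < e -> \forall n \near \oo,
   (sqint D (u n) <= ((1 + e) * a + (1 + e^-1) *
      fine (sqint D (fun x => u n x - f x)))%:E)%E /\
   (a%:E <= (1 + e)%:E * sqint D (u n) + ((1 + e^-1) *
      fine (sqint D (fun x => u n x - f x)))%:E)%E.
  move=> e0; near=> n.
  have fn : sqint D (fun x => u n x - f x) \is a fin_num by near: n.
  rewrite EFinD !EFinM !fineK//; split; first exact: sqint_perturb.
  rewrite sqint_subC.
  exact: sqint_perturb.
have ufin n : sqint D (u n) \is a fin_num by rewrite ge0_fin_numE ?sqint_ge0.
split; first exact: nearW.
apply/cvgrPdist_le => /= e e0.
(* With this parameter k a <= e / 4 and k sqint (u n) <= 3 e / 4. *)
pose k := Num.min 1 (e / (4 * (1 + a + e))).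
have ae0 : 0 < 1 + a + e by rewrite addr_gt0// ltr_wpDr.
have k0 : 0 < k by rewrite lt_min ltr01 divr_gt0// mulr_gt0.
have k1 : k <= 1 by rewrite ge_min lexx.
have k2 : k * (1 + a + e) <= e / 4.
  have : k <= e / (4 * (1 + a + e)) by rewrite ge_min lexx orbT.
  rewrite -(ler_pM2r ae0) => /le_trans; apply.
  rewrite (_ : e / (4 * (1 + a + e)) * (1 + a + e) = e / 4)//.
  by field; rewrite gt_eqF.
clearbody k.
have dk0 : 0 < e / 4 / (1 + k^-1).
  by rewrite divr_gt0 ?divr_gt0// addr_gt0// invr_gt0.
near=> n.
have [H1 H2] : (sqint D (u n) <= ((1 + k) * a + (1 + k^-1) *
      fine (sqint D (fun x => u n x - f x)))%:E)%E /\
   (a%:E <= (1 + k)%:E * sqint D (u n) + ((1 + k^-1) *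
      fine (sqint D (fun x => u n x - f x)))%:E)%E.
  by near: n; exact: lebound.
have Dn : fine (sqint D (fun x => u n x - f x)) <= e / 4 / (1 + k^-1).
  have : `|0 - fine (sqint D (fun x => u n x - f x))| <= e / 4 / (1 + k^-1).
    by near: n; move/cvgrPdist_le : D0; exact.
  by rewrite sub0r normrN; apply: le_trans; exact: ler_norm.
have {}Dn : (1 + k^-1) * fine (sqint D (fun x => u n x - f x)) <= e / 4.
  by rewrite mulrC -ler_pdivlMr// addr_gt0// invr_gt0.
move: H1 H2; rewrite -(fineK (ufin n)) -!EFinM -!EFinD !lee_fin.
have u0 : 0 <= fine (sqint D (u n)) by rewrite fine_ge0// sqint_ge0.
move: Dn u0; rewrite /comp.
set x := fine (sqint D (u n)); set y := _ * fine _ => Dn u0 H1 H2.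
have ka : k * a <= e / 4.
  by apply: le_trans k2; rewrite ler_pM2l//; lra.
have kx : k * x <= e / 2 + e / 4.
  have H : k * x <= k * ((1 + k) * a + e / 4).
    by rewrite ler_pM2l// (le_trans H1)// lerD2l.
  apply: le_trans H _; rewrite mulrDr mulrCA; apply: lerD; last first.
    by rewrite ler_piMl// divr_ge0// ltW.
  have : (1 + k) * (k * a) <= 2 * (e / 4).
    by apply: ler_pM => //; [rewrite addr_ge0// ltW|rewrite mulr_ge0// ltW|lra].
  lra.
rewrite ler_norml; apply/andP; rewrite /=; lra.
Unshelve. all: by end_near. Qed.

End square_integrals.

(** * Independence *)

Section independence.
Context d (T : measurableType d) (R : realType) (P : probability T R).

(** Independence makes the joint law of (X, Y) the product of the marginal laws,
    so Fubini integrates out Y first and finds its mean, zero. *)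
Lemma integral_indep_mul (X Y : T -> R) :
  X \in Lfun P 2%:E -> Y \in Lfun P 2%:E ->
  (forall A B : set R, measurable A -> measurable B ->
    P (X @^-1` A `&` Y @^-1` B) = (P (X @^-1` A) * P (Y @^-1` B))%E) ->
  (\int[P]_x (Y x)%:E = 0)%E ->
  (\int[P]_x (X x * Y x)%:E = 0)%E.
Proof.
move=> X2 Y2 indep EY0.
have [mX _] := (Lfun2P P X).1 X2.
have [mY _] := (Lfun2P P Y).1 Y2.
have iXY : P.-integrable setT (EFin \o (fun x => X x * Y x)).
  exact/Lfun1_integrable/Lfun2_mul_Lfun1.
have iY : P.-integrable setT (EFin \o Y).
  apply/Lfun1_integrable/Lfun_subset12 => //.
  by apply: fin_num_measure; exact: measurableT.
pose phi x : R * R := (X x, Y x).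
have mphi : measurable_fun setT phi by exact: measurable_fun_pair.
pose phi' : {RV P >-> (R * R)%type} := mfun_Sub (mem_set mphi).
pose X' : {RV P >-> R} := mfun_Sub (mem_set mX).
pose Y' : {RV P >-> R} := mfun_Sub (mem_set mY).
pose f (z : R * R) : \bar R := (z.1 * z.2)%:E.
have mf : measurable_fun setT f.
  apply/measurable_EFinP; apply: measurable_funM; first exact: measurable_fst.
  exact: measurable_snd.
pose PX : probability _ _ := distribution P X'.
pose PY : probability _ _ := distribution P Y'.
have prodE A : measurable A -> (PX \x PY)%E A = distribution P phi' A.
  move=> mA.
  have := @product_measure_unique _ _ _ _ _ PX PY (distribution P phi').
  by move=> /(_ _ A mA); apply=> B C mB mC; exact: indep.
have iprod : (PX \x PY)%E.-integrable setT f.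
  apply/integrableP; split => //.
  rewrite (@eq_measure_integral _ _ _ _ (distribution P phi')); last first.
    by move=> A mA _; exact: prodE.
  rewrite ge0_integral_distribution//; last exact: measurableT_comp.
  by have /integrableP[] := iXY.
transitivity (\int[(PX \x PY)%E]_z f z)%E.
  rewrite (@eq_measure_integral _ _ _ _ (distribution P phi')); last first.
    by move=> A mA _; exact: prodE.
  by rewrite integral_distribution.
rewrite -(integral12_prod_meas1 iprod).
apply: integral0_eq => x _; rewrite /fubini_F /f /=.
transitivity (\int[PY]_y (x%:E * y%:E))%E; first by [].
have iPY : PY.-integrable setT (EFin : R -> \bar R).
  by apply: (@integrable_pushforward _ _ _ _ _ Y' _ P).
rewrite integralZl// (_ : \int[PY]_y y%:E = 0)%E ?mule0// -EY0.
by rewrite -(@integral_distribution _ _ _ _ _ _ Y' (EFin : R -> \bar R)).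
Qed.

Lemma sqint_indep (X Y : T -> R) :
  X \in Lfun P 2%:E -> Y \in Lfun P 2%:E ->
  (forall A B : set R, measurable A -> measurable B ->
    P (X @^-1` A `&` Y @^-1` B) = (P (X @^-1` A) * P (Y @^-1` B))%E) ->
  (\int[P]_x (Y x)%:E = 0)%E ->
  sqint P setT (fun x => X x + Y x) = (sqint P setT X + sqint P setT Y)%E.
Proof.
move=> X2 Y2 indep EY0.
have EXY := integral_indep_mul X2 Y2 indep EY0.
have iXY : P.-integrable setT (EFin \o (fun x => X x * Y x)).
  exact/Lfun1_integrable/Lfun2_mul_Lfun1.
have iX := Lfun2_integrable_sqr X2.
have iY := Lfun2_integrable_sqr Y2.
rewrite /sqint.
transitivity (\int[P]_x ((X x ^+ 2)%:E + (2%:E * (X x * Y x)%:E + (Y x ^+ 2)%:E)))%E.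
  apply: eq_integral => x _; rewrite -EFinM -!EFinD; congr (_%:E); ring.
rewrite integralD//; last first.
  by apply: integrableD => //; exact: integrableZl.
rewrite integralD//; last exact: integrableZl.
by rewrite integralZl// EXY mule0 add0e.
Qed.

End independence.

(** * Completeness of L^2 *)

Lemma nneseries_le_bound (R : realType) (u : nat -> \bar R) (M : \bar R) :
  (forall n, (0 <= u n)%E) -> (forall n, (\sum_(0 <= k < n) u k <= M)%E) ->
  (\sum_(0 <= k <oo) u k <= M)%E.
Proof.
move=> u0 uM; apply: lime_le; last exact: nearW.
by apply: is_cvg_nneseries => n _ _; exact: u0.
Qed.

Lemma sum_half_powers (R : realType) n :
  \sum_(0 <= k < n) (2 ^- k.+1 : R) = 1 - 2 ^- n.
Proof.
elim: n => [|n IH]; first by rewrite big_nil expr0 invr1 subrr.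
rewrite big_nat_recr//= IH exprS invfM.
have : (2 ^- n : R) = 2 * (2^-1 * 2 ^- n) by rewrite mulrA divff ?mul1r.
lra.
Qed.

(** The increments are absolutely summable, since AM-GM gives
    |a| <= c a^2 + 1 / c with c = 2^(k+1). *)
Lemma cvg_of_weighted_sum_sqr (R : realType) (v : nat -> R) (M : R) :
  (forall n, \sum_(0 <= k < n) 2 ^+ k.+1 * (v k.+1 - v k) ^+ 2 <= M) ->
  cvgn v.
Proof.
move=> bnd; pose dl k := v k.+1 - v k.
have cvgd : cvgn (series dl).
  apply: normed_cvg; apply: nondecreasing_is_cvgn.
    by apply: nondecreasing_series => n _ _; exact: normr_ge0.
  exists (M + 1) => _ [n _ <-]; rewrite /series/=.
  apply: (@le_trans _ _ (\sum_(0 <= k < n)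
      (2 ^+ k.+1 * (v k.+1 - v k) ^+ 2 + 2 ^- k.+1))).
    apply: ler_sum => k _; rewrite /dl.
    set a := v k.+1 - v k; set c := 2 ^+ k.+1.
    have c0 : 0 < c by rewrite exprn_gt0.
    rewrite -(ler_pM2l c0) mulrDr divff ?gt_eqF// -[a ^+ 2]real_normK ?num_real//.
    have := sqr_ge0 (c * `|a| - 1); nra.
  rewrite big_split/= sum_half_powers; apply: lerD; first exact: bnd.
  by rewrite lerBlDr lerDl invr_ge0 exprn_ge0.
have -> : v = cst (v 0%N) \+ series dl.
  apply/funext => n; rewrite /= /series /= /dl telescope_sumr//.
  by rewrite addrC subrK.
by apply: is_cvgD => //; exact: is_cvg_cst.
Qed.

Section completeness.
Context d (T : measurableType d) (R : realType) (mu : {measure set T -> \bar R}).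

(** Along a fast subsequence v the weighted sum of the squares of the increments
    has finite integral, hence is finite almost everywhere and v converges
    there; Fatou's lemma then bounds the distance from u n to the limit. *)
Lemma sqint_complete (u : nat -> T -> R) :
  (forall n, measurable_fun setT (u n)) ->
  (forall e : R, 0 < e -> exists N, forall m n, (N <= m)%N -> (N <= n)%N ->
     (sqint mu setT (fun x => u m x - u n x)%R <= e%:E)%E) ->
  exists2 f : T -> R, measurable_fun setT f &
    forall e : R, 0 < e -> exists N, forall n, (N <= n)%N ->
      (sqint mu setT (fun x => u n x - f x)%R <= e%:E)%E.
Proof.
move=> mu_ cauchy.
have /choice[N_ N_P] k : exists N, forall m n, (N <= m)%N -> (N <= n)%N ->
    (sqint mu setT (fun x => u m x - u n x)%R <= (2 ^- k.+1 * 2 ^- k.+1)%:E)%E.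
  by apply: cauchy; rewrite mulr_gt0// invr_gt0 exprn_gt0.
(* A cumulated sum, so that nk is monotone, dominates N_ and is unbounded. *)
pose nk k := (\sum_(j < k.+1) (N_ j).+1)%N.
have nkS k : (nk k <= nk k.+1)%N by rewrite /nk [leqRHS]big_ord_recr/= leq_addr.
have nkN k : (N_ k <= nk k)%N.
  by rewrite /nk big_ord_recr/= (leq_trans (leqnSn _))// leq_addl.
have nkk k : (k <= nk k)%N.
  elim: k => // k IH; rewrite /nk big_ord_recr/= -/(nk k).
  by rewrite addnS ltnS (leq_trans IH)// leq_addr.
pose v k := u (nk k).
have mv k : measurable_fun setT (v k) by exact: mu_.
have mdv k : measurable_fun setT (fun x => v k.+1 x - v k x).
  exact: measurable_funB.
pose g k x : \bar R := ((2 ^+ k.+1)%:E * ((v k.+1 x - v k x) ^+ 2)%:E)%E.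
have g0 k x : (0 <= g k x)%E.
  by rewrite /g -EFinM lee_fin mulr_ge0 ?sqr_ge0 ?exprn_ge0.
have mg k : measurable_fun setT (g k).
  by apply: measurable_funeM; exact: measurable_sqr.
pose G x := (\sum_(0 <= k <oo) g k x)%E.
have mG : measurable_fun setT G by exact: ge0_emeasurable_sum.
have iG : mu.-integrable setT G.
  apply/integrableP; split => //.
  apply: (@le_lt_trans _ _ 1%E); last exact: ltry.
  under eq_integral do rewrite gee0_abs ?nneseries_ge0//.
  rewrite integral_nneseries//.
  apply: nneseries_le_bound => [n|n]; first exact: integral_ge0.
  apply: (@le_trans _ _ (\sum_(0 <= k < n) (2 ^- k.+1)%:E)%E); last first.
    by rewrite sumEFin sum_half_powers lee_fin lerBlDr lerDl invr_ge0 exprn_ge0.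
  apply: lee_sum => k _; rewrite ge0_integralZl_EFin//; last 2 first.
  - by move=> x _; rewrite lee_fin sqr_ge0.
  - exact: measurable_sqr.
  apply: (@le_trans _ _ ((2 ^+ k.+1)%:E * (2 ^- k.+1 * 2 ^- k.+1)%:E)%E).
    rewrite lee_pmul2l ?lte_fin ?exprn_gt0//.
    by apply: N_P => //; exact: leq_trans (nkS k).
  by rewrite -EFinM mulrA divff ?mul1r// expf_neq0.
(* The upper limit is measurable and is the limit wherever v converges. *)
pose f x := fine (limn_esup (fun k => (v k x)%:E)).
have mf : measurable_fun setT f.
  apply: measurableT_comp => //.
  by apply: measurable_fun_limn_esup => k; exact/measurable_EFinP.
have aecvg : {ae mu, forall x, v k x @[k --> \oo] --> f x}.
  have := integrable_ae measurableT iG; apply: filterS => x /(_ I) Gx.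
  suff cv : cvgn (v ^~ x).
    have -> : f x = limn (v ^~ x); last exact: cv.
    rewrite /f (_ : limn_esup _ = (limn (v ^~ x))%:E)//.
    have h : (v k x)%:E @[k --> \oo] --> (limn (v ^~ x))%:E.
      by apply/fine_cvgP; split; [exact: nearW|exact: cv].
    by rewrite (cvg_limn_einf_sup h).2.
  apply: (@cvg_of_weighted_sum_sqr _ _ (fine (G x))) => n.
  rewrite -lee_fin fineK// -sumEFin.
  by apply: (@nneseries_lim_ge R (g ^~ x) xpredT 0 n) => k _ _; exact: g0.
exists f => // e e0; have [N NP] := cauchy _ e0; exists N => n Nn.
rewrite /sqint.
rewrite (ae_eq_integral (fun x =>
    limn_einf (fun k => ((u n x - v k x) ^+ 2)%:E))) //; last 3 first.
- by apply: measurable_sqr; exact: measurable_funB.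
- apply: measurableT_comp => //; apply: measurable_fun_limn_esup => k.
  apply: measurableT_comp => //.
  by apply: measurable_sqr; exact: measurable_funB.
- move: aecvg; apply: filterS => x vf _.
  have h : ((u n x - v k x) ^+ 2)%:E @[k --> \oo] --> ((u n x - f x) ^+ 2)%:E.
    apply/fine_cvgP; split; first exact: nearW.
    have hB : (u n x - v k x) @[k --> \oo] --> u n x - f x.
      by apply: cvgB => //; exact: cvg_cst.
    by rewrite expr2; under eq_fun do rewrite /= expr2; exact: cvgM.
  by rewrite (cvg_limn_einf_sup h).1.
apply: le_trans (fatou _ _ _ _) _ => //.
- by move=> k; apply: measurable_sqr; exact: measurable_funB.
- by move=> k x _; rewrite lee_fin sqr_ge0.
rewrite limn_einf_lim; apply: lime_le.
  exact: is_cvg_einfs.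
near=> k; apply: ereal_inf_le; exists (sqint mu setT (fun x => u n x - v k x)%R).
  by exists k => /=.
apply: NP => //; apply: leq_trans (nkk k).
by near: k; exact: nbhs_infty_ge.
Unshelve. all: by end_near. Qed.

End completeness.

(** * The inner product on the sphere *)

Section hilbert.
Context (R : realType).
Notation H := (L2S R).
Notation mu := (@surface_area R).
Implicit Types f g h : H.

Lemma L2S_Lfun f : (f : sphere R -> R) \in Lfun mu 2%:E.
Proof. exact: LfunP. Qed.

Lemma measurable_L2S f : measurable_fun setT f.
Proof. by have /Lfun2P[] := L2S_Lfun f. Qed.

Lemma L2S_mul_integrable f g :
  mu.-integrable setT (EFin \o (fun x => f x * g x)).
Proof. exact/Lfun1_integrable/(Lfun2_mul_Lfun1 (L2S_Lfun f) (L2S_Lfun g)). Qed.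

Lemma L2S_of (f : sphere R -> R) : measurable_fun setT f ->
  (sqint mu setT f < +oo)%E -> exists g : H, forall x, g x = f x.
Proof.
move=> mf foo; have f2 : f \in Lfun mu 2%:E by apply/Lfun2P.
by exists (Lfun_Sub (lee1n 2) f2) => x.
Qed.

Lemma innerC f g : inner f g = inner g f.
Proof. by apply: eq_Rintegral => x _; rewrite mulrC. Qed.

Lemma innerDl f g h : inner (f + g) h = inner f h + inner g h.
Proof.
rewrite /inner -RintegralD//; try exact: L2S_mul_integrable.
by apply: eq_Rintegral => x _; rewrite -mulrDl.
Qed.

Lemma innerZl a f g : inner (a *: f) g = a * inner f g.
Proof.
rewrite /inner -RintegralZl//; last exact: L2S_mul_integrable.
by apply: eq_Rintegral => x _; rewrite mulrA.
Qed.

Lemma inner0l f : inner 0 f = 0.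
Proof. by rewrite -(scale0r (0 : H)) innerZl mul0r. Qed.

Lemma innerNl f g : inner (- f) g = - inner f g.
Proof. by rewrite -scaleN1r innerZl mulN1r. Qed.

Lemma innerBl f g h : inner (f - g) h = inner f h - inner g h.
Proof. by rewrite innerDl innerNl. Qed.

Lemma inner_suml I (r : seq I) (p : pred I) (F : I -> H) g :
  inner (\sum_(i <- r | p i) F i) g = \sum_(i <- r | p i) inner (F i) g.
Proof.
elim: r => [|i r IH]; first by rewrite !big_nil inner0l.
by rewrite !big_cons; case: ifP => // _; rewrite innerDl IH.
Qed.

Lemma innerDr f g h : inner h (f + g) = inner h f + inner h g.
Proof. by rewrite innerC innerDl !(innerC h). Qed.

Lemma innerZr a f g : inner f (a *: g) = a * inner f g.
Proof. by rewrite innerC innerZl innerC. Qed.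

Lemma innerBr f g h : inner h (f - g) = inner h f - inner h g.
Proof. by rewrite innerC innerBl !(innerC h). Qed.

Lemma inner_sumr I (r : seq I) (p : pred I) (F : I -> H) g :
  inner g (\sum_(i <- r | p i) F i) = \sum_(i <- r | p i) inner g (F i).
Proof.
by rewrite innerC inner_suml; apply: eq_bigr => i _; rewrite innerC.
Qed.

Lemma sqint_inner f : sqint mu setT f = (inner f f)%:E.
Proof.
rewrite /inner /Rintegral fineK; last first.
  exact: integrable_fin_num (L2S_mul_integrable f f).
by apply: eq_integral => x _; rewrite expr2.
Qed.

Lemma inner_ge0 f : 0 <= inner f f.
Proof. by rewrite -lee_fin -sqint_inner sqint_ge0. Qed.

Lemma hnorm_ge0 f : 0 <= hnorm f.
Proof. exact: sqrtr_ge0. Qed.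

Lemma sqr_hnorm f : hnorm f ^+ 2 = inner f f.
Proof. by rewrite sqr_sqrtr ?inner_ge0. Qed.

(** Squared form of Cauchy-Schwarz.  The form is only semi-definite on
    representatives, so the case of a null g is separate. *)
Lemma inner_sqr_le f g : inner f g ^+ 2 <= inner f f * inner g g.
Proof.
have key a : 0 <= inner f f + 2 * a * inner f g + a ^+ 2 * inner g g.
  have := inner_ge0 (f + a *: g).
  rewrite innerDl !innerDr innerZl !innerZr innerZl (innerC g f).
  move=> H; apply: (le_trans H).
  by rewrite le_eqVlt; apply/orP; left; apply/eqP; ring.
have [g0|g0] := eqVneq (inner g g) 0.
  have [c0|c0] := eqVneq (inner f g) 0; first by rewrite c0 expr0n/= g0 mulr0.
  have := key (- (inner f f + 1) / (2 * inner f g)); rewrite g0 mulr0 addr0.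
  rewrite (_ : 2 * _ * _ = - (inner f f + 1)); first lra.
  by field; rewrite c0.
have gg : 0 < inner g g by rewrite lt0r g0 inner_ge0.
have := key (- inner f g / inner g g).
rewrite (_ : _ + _ + _ = inner f f - inner f g ^+ 2 / inner g g); last by field.
by rewrite subr_ge0 ler_pdivrMr.
Qed.

Lemma cauchy_schwarz f g : `|inner f g| <= hnorm f * hnorm g.
Proof.
rewrite -[leRHS]ger0_norm ?mulr_ge0 ?hnorm_ge0//.
by rewrite -ler_sqr ?nnegrE// !real_normK ?num_real// exprMn !sqr_hnorm inner_sqr_le.
Qed.

Lemma hnorm_sub f g : hnorm (f - g) = hnorm (g - f).
Proof.
by rewrite /hnorm -opprB innerNl [in X in Num.sqrt X](innerC _ (- _)) innerNl opprK.
Qed.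

Lemma ae_inner f g h : f = g %[ae mu] -> inner f h = inner g h.
Proof.
move=> fg; rewrite /inner /Rintegral; congr fine.
apply: ae_eq_integral => //.
- by have /integrableP[] := L2S_mul_integrable f h.
- by have /integrableP[] := L2S_mul_integrable g h.
- by apply: filterS fg => x /= fgx xT; rewrite fgx.
Qed.

End hilbert.

(** * Spherical harmonics as an orthonormal basis *)

Section spectral.
Context (R : realType) (Y : nat -> int -> L2S R).
Hypothesis hY : real_spherical_harmonics Y.
Notation H := (L2S R).
Notation mu := (@surface_area R).
Implicit Types (f g h w : H) (c : nat -> int -> R).
Notation hs := (harmonic_series Y).

Lemma order_bound l (k : 'I_(l.*2.+1)) : `|k%:Z - l%:Z| <= l%:Z.
Proof. by have := ltn_ord k; rewrite ler_norml; lia. Qed.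

Lemma sum_order_ge0 l (F : int -> R) : (forall m, 0 <= F m) -> 0 <= sum_order l F.
Proof. by move=> F0; apply: sumr_ge0 => k _; exact: F0. Qed.

(** Orders are indexed by k = m + l, as in the sums over the orders. *)
Lemma inner_harmonics l (k : 'I_(l.*2.+1)) l' (k' : 'I_(l'.*2.+1)) :
  inner (Y l (k%:Z - l%:Z)) (Y l' (k'%:Z - l'%:Z)) =
  ((l == l') && (k == k' :> nat))%:R.
Proof.
rewrite (sh_orthonormal hY) ?order_bound//.
have [E|//] := eqVneq l l'; subst l'; congr ((_ && _)%:R).
by apply/eqP/eqP => [|->//]; lia.
Qed.

Lemma inner_harmonic_series c n f : inner (hs c n) f =
  \sum_(0 <= l < n) sum_order l (fun m => c l m * inner f (Y l m)).
Proof.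
rewrite inner_suml big_mkord; apply: eq_bigr => l _.
rewrite inner_suml; apply: eq_bigr => k _.
by rewrite innerZl innerC.
Qed.

Lemma harmonic_series_coef c n l (k : 'I_(l.*2.+1)) :
  inner (hs c n) (Y l (k%:Z - l%:Z)) =
  if (l < n)%N then c l (k%:Z - l%:Z) else 0.
Proof.
rewrite inner_harmonic_series big_mkord.
have H l' (k' : 'I_(l'.*2.+1)) : l' != l ->
    c l' (k'%:Z - l'%:Z) * inner (Y l (k%:Z - l%:Z)) (Y l' (k'%:Z - l'%:Z)) = 0.
  by move=> ll'; rewrite inner_harmonics eq_sym (negbTE ll') mulr0.
case: ifPn => ln.
  rewrite (bigD1 (Ordinal ln))//= [X in _ + X]big1 ?addr0; last first.
    by move=> l' ll'; apply: big1 => k' _; exact: H.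
  rewrite /sum_order (bigD1 k)//= big1 ?addr0; last first.
    by move=> k' kk'; rewrite inner_harmonics eqxx/= val_eqE eq_sym (negbTE kk') mulr0.
  by rewrite inner_harmonics !eqxx mulr1.
apply: big1 => l' _; apply: big1 => k' _; apply: H.
by apply: contraNneq ln => <-.
Qed.

Definition sqcoef c n : R := \sum_(0 <= l < n) sum_order l (fun m => c l m ^+ 2).

Lemma inner_harmonic_series2 c m n : (m <= n)%N ->
  inner (hs c m) (hs c n) = sqcoef c m.
Proof.
move=> mn; rewrite inner_harmonic_series; apply: eq_big_nat => l /andP[_ lm].
apply: eq_bigr => k _; rewrite innerC innerC harmonic_series_coef expr2.
by rewrite (leq_trans lm mn).
Qed.

Lemma harmonic_series_dist c m n : (m <= n)%N ->
  hnorm (hs c n - hs c m) ^+ 2 = sqcoef c n - sqcoef c m.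
Proof.
move=> mn; rewrite sqr_hnorm innerBl !innerBr (innerC (hs c n) (hs c m)).
rewrite !inner_harmonic_series2//; ring.
Qed.

Lemma cvg_inner (u : nat -> H) w g : converges_to u w ->
  inner (u n) g @[n --> \oo] --> inner w g.
Proof.
move=> uw; apply/cvgrPdistC_le => e e0.
have g0 : 0 < hnorm g + 1 by rewrite ltr_wpDl ?hnorm_ge0.
near=> n; rewrite -innerBl (le_trans (cauchy_schwarz _ _))//.
have H1 : hnorm (u n - w) <= e / (hnorm g + 1).
  have : `|0 - hnorm (u n - w)| <= e / (hnorm g + 1).
    by near: n; move/cvgrPdist_le : uw; apply; rewrite divr_gt0.
  by rewrite sub0r normrN ger0_norm ?hnorm_ge0.
apply: (@le_trans _ _ (e / (hnorm g + 1) * (hnorm g + 1))).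
  by rewrite ler_pM ?hnorm_ge0// lerDl.
by rewrite divfK// gt_eqF.
Unshelve. all: by end_near. Qed.

Lemma converges_coef c w l (k : 'I_(l.*2.+1)) : converges_to (hs c) w ->
  inner w (Y l (k%:Z - l%:Z)) = c l (k%:Z - l%:Z).
Proof.
move=> /cvg_inner - /(_ (Y l (k%:Z - l%:Z))) cw.
rewrite -(cvg_lim _ cw)//; apply/cvg_lim => //.
apply: cvg_near_cst; near=> n; rewrite harmonic_series_coef ifT//.
by near: n; exact: nbhs_infty_gt.
Unshelve. all: by end_near. Qed.

(** Polarised Parseval identity, as a limit over the degree. *)
Lemma cvg_parseval f g :
  \sum_(0 <= l < n) sum_order l (fun m => inner f (Y l m) * inner g (Y l m))
    @[n --> \oo] --> inner f g.
Proof.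
have := @cvg_inner _ _ g (sh_complete hY f).
by under eq_fun do rewrite inner_harmonic_series.
Qed.

Lemma parseval f : (inner f f)%:E =
  (\sum_(0 <= l <oo) (sum_order l (fun m => inner f (Y l m) ^+ 2))%:E)%E.
Proof.
apply/esym/cvg_lim => //.
under eq_fun do rewrite sumEFin.
apply/fine_cvgP; split; first exact: nearW.
exact: cvg_parseval.
Qed.

(** The partial sums are Cauchy because their squared distances are the
    differences of the partial sums of the squared coefficients. *)
Lemma riesz_fischer c :
  (\sum_(0 <= l <oo) (sum_order l (fun m => c l m ^+ 2))%:E < +oo)%E ->
  exists w, converges_to (hs c) w.
Proof.
move=> coo; set M := (X in (X < _)%E) in coo.
have so0 l : 0 <= sum_order l (fun m => c l m ^+ 2).
  by apply: sum_order_ge0 => m; exact: sqr_ge0.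
have Mfin : M \is a fin_num.
  by rewrite ge0_fin_numE//; apply: nneseries_ge0 => l _ _; rewrite lee_fin.
have nd : nondecreasing_seq (sqcoef c).
  by apply: nondecreasing_series => l _ _; exact: so0.
have cvS : cvgn (sqcoef c).
  apply: nondecreasing_is_cvgn => //; exists (fine M) => _ [n _ <-].
  rewrite -lee_fin fineK// /sqcoef -sumEFin; apply: nneseries_lim_ge => l _ _.
  by rewrite lee_fin.
have dist_le (e : R) : 0 < e -> exists N, forall m n, (N <= m)%N -> (N <= n)%N ->
    hnorm (hs c m - hs c n) ^+ 2 <= e.
  move=> e0; have e20 : 0 < e / 2 by rewrite divr_gt0.
  have /cvgrPdist_le /(_ _ e20) [N _ NP] := cvS.
  exists N => m n Nm Nn; wlog mn : m n Nm Nn / (m <= n)%N.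
    by move=> W; have [/W->//|/ltnW/W] := leqP m n; rewrite hnorm_sub; exact.
  rewrite hnorm_sub harmonic_series_dist//.
  have := NP _ Nm; have := NP _ Nn => /=; rewrite !ler_norml => /andP[? ?] /andP[? ?].
  lra.
have mhs n : measurable_fun setT (hs c n) by exact: measurable_L2S.
have sqE m n : sqint mu setT (fun x => hs c m x - hs c n x) =
    (hnorm (hs c m - hs c n) ^+ 2)%:E by rewrite sqr_hnorm -sqint_inner.
have [e e0|f mf fP] := @sqint_complete _ _ _ mu _ mhs.
  have [N NP] := dist_le _ e0; exists N => m n Nm Nn.
  by rewrite sqE lee_fin NP.
have foo : (sqint mu setT f < +oo)%E.
  have [N NP] := fP _ ltr01.
  have := sqint_perturb mu measurableT ltr01 mf (mhs N).
  move=> /le_lt_trans; apply; rewrite lte_add_pinfty//.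
    by rewrite sqint_inner -EFinM ltry.
  rewrite sqint_subC lte_mul_pinfty//.
  by rewrite (le_lt_trans (NP _ (leqnn _)))// ltry.
have [w wE] := L2S_of mf foo; exists w.
apply/cvgrPdist_le => e e0; have e20 : 0 < e ^+ 2 by rewrite exprn_gt0.
have [N NP] := fP _ e20; exists N => // n Nn /=.
rewrite sub0r normrN ger0_norm ?hnorm_ge0// -ler_sqr ?nnegrE ?hnorm_ge0 ?(ltW e0)//.
rewrite -lee_fin sqr_hnorm -sqint_inner; apply: le_trans (NP _ Nn).
rewrite le_eqVlt; apply/orP; left; apply/eqP; apply: eq_integral => x _.
by rewrite -wE.
Qed.

(** The candidate has the coefficients phi (Y l m).  Testing phi on their
    partial sum G gives |G|^2 = phi G <= C |G|, which bounds the sum of squares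
    by C^2, so Riesz-Fischer produces the vector; the identity extends from
    partial sums by continuity of phi. *)
Lemma riesz_representation (phi : H -> R) (C : R) :
  (forall a f g, phi (a *: f + g) = a * phi f + phi g) ->
  (forall f, `|phi f| <= C * hnorm f) ->
  exists h, forall f, phi f = inner f h.
Proof.
move=> lin bnd; pose c l m := phi (Y l m).
have phi0 : phi 0 = 0.
  have := lin 1 0 0; rewrite scaler0 addr0 mul1r => /eqP.
  by rewrite -subr_eq0 opprD addNKr oppr_eq0 => /eqP.
have phiD f g : phi (f + g) = phi f + phi g by rewrite -(scale1r f) lin mul1r scale1r.
have phiZ a f : phi (a *: f) = a * phi f by rewrite -(addr0 (a *: f)) lin phi0 addr0.
have phi_sum n (F : 'I_n -> H) : phi (\sum_i F i) = \sum_i phi (F i).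
  by rewrite (big_morph phi phiD phi0).
have phi_hs b n : phi (hs b n) = \sum_(0 <= l < n) sum_order l (fun m => b l m * c l m).
  rewrite phi_sum big_mkord; apply: eq_bigr => l _; rewrite phi_sum.
  by apply: eq_bigr => k _; rewrite phiZ.
have sqc n : sqcoef c n <= C ^+ 2.
  have E : phi (hs c n) = sqcoef c n.
    by rewrite phi_hs; apply: eq_bigr => l _; apply: eq_bigr => k _; rewrite expr2.
  have := bnd (hs c n); rewrite E.
  have : hnorm (hs c n) ^+ 2 = sqcoef c n by rewrite sqr_hnorm inner_harmonic_series2.
  have := hnorm_ge0 (hs c n); set x := hnorm _; set s := sqcoef c n => x0 xs sC.
  have s0 : 0 <= s by rewrite -xs sqr_ge0.
  rewrite ger0_norm// in sC.
  by have := sqr_ge0 (x - C); nra.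
have [h hh] : exists w, converges_to (hs c) w.
  apply: riesz_fischer; apply: (@le_lt_trans _ _ (C ^+ 2)%:E); last exact: ltry.
  apply: nneseries_le_bound => n.
    by rewrite lee_fin; apply: sum_order_ge0 => m; exact: sqr_ge0.
  by rewrite sumEFin lee_fin; exact: sqc.
exists h => f.
have H1 : phi (hs (fun l m => inner f (Y l m)) n) @[n --> \oo] --> phi f.
  have := sh_complete hY f; set u := hs _ => uf.
  apply/cvgrPdistC_le => e e0.
  have K0 : 0 < `|C| + 1 by rewrite ltr_wpDl.
  near=> n.
  have -> : phi (u n) - phi f = phi (u n - f).
    by rewrite phiD -(scaleN1r f) phiZ mulN1r.
  apply: le_trans (bnd _) _.
  have H1 : hnorm (u n - f) <= e / (`|C| + 1).
    have : `|0 - hnorm (u n - f)| <= e / (`|C| + 1).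
      by near: n; move/cvgrPdist_le : uf; apply; rewrite divr_gt0.
    by rewrite sub0r normrN ger0_norm ?hnorm_ge0.
  apply: (@le_trans _ _ ((`|C| + 1) * (e / (`|C| + 1)))).
    apply: (@le_trans _ _ ((`|C| + 1) * hnorm (u n - f))).
      by rewrite ler_wpM2r ?hnorm_ge0// (le_trans (ler_norm _))// lerDl.
    by rewrite ler_pM2l.
  by rewrite mulrC divfK// gt_eqF.
rewrite -(cvg_lim _ H1)//; apply/cvg_lim => //.
have := @cvg_parseval f h; apply: cvg_trans; apply: near_eq_cvg; apply: nearW => n.
rewrite /= phi_hs.
apply: eq_bigr => l _; apply: eq_bigr => k _.
by rewrite (converges_coef _ hh).
Unshelve. all: by end_near. Qed.

(** T is linear only up to null sets, which the inner product does not see, so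
    f |-> <T f, g> is linear and [riesz_representation] applies to it. *)
Lemma adjoint_exists (T : H -> H) g : bounded_linear T ->
  exists h, forall f, inner (T f) g = inner f h.
Proof.
move=> [lin [C bnd]].
apply: (@riesz_representation (fun f => inner (T f) g) (C * hnorm g)).
  by move=> a f f'; rewrite (ae_inner _ (lin a f f')) innerDl innerZl.
move=> f; apply: le_trans (cauchy_schwarz _ _) _.
by rewrite mulrAC ler_wpM2r ?hnorm_ge0.
Qed.

End spectral.

(** * Functional calculus and the energy series *)

Section functional_calculus.
Context (R : realType) (Y : nat -> int -> L2S R).
Hypothesis hY : real_spherical_harmonics Y.
Notation H := (L2S R).
Implicit Types (f g w u : H) (phi : R -> R).

Lemma fcalcP phi f : fcalc_dom Y phi f -> is_fcalc Y phi f (fcalc Y phi f).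
Proof. by move=> fdom; rewrite /fcalc; have := xgetPex 0 fdom. Qed.

Lemma inner_fcalc phi f l (k : 'I_(l.*2.+1)) : fcalc_dom Y phi f ->
  inner (fcalc Y phi f) (Y l (k%:Z - l%:Z)) =
  phi (eigval R l) * inner f (Y l (k%:Z - l%:Z)).
Proof. by move=> /fcalcP /(converges_coef hY) ->. Qed.

Lemma parseval_fcalc phi f w : is_fcalc Y phi f w ->
  (inner w w)%:E = (\sum_(0 <= l <oo) (sum_order l
    (fun m => (phi (eigval R l) * inner f (Y l m)) ^+ 2))%:E)%E.
Proof.
move=> fw; rewrite (parseval hY); apply: eq_eseriesr => l _; congr (_%:E).
by apply: eq_bigr => k _; rewrite (converges_coef hY _ fw).
Qed.

(** The domain is where the multiplied coefficients are square summable: one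
    direction is Parseval, the other Riesz-Fischer. *)
Lemma fcalc_domE phi f : fcalc_dom Y phi f <->
  (\sum_(0 <= l <oo) (sum_order l
    (fun m => (phi (eigval R l) * inner f (Y l m)) ^+ 2))%:E < +oo)%E.
Proof.
split=> [[w /parseval_fcalc <-]|]; first exact: ltry.
by move=> /(riesz_fischer hY).
Qed.

Lemma fcalc_dom_le phi psi f (C : R) :
  (forall l, `|phi (eigval R l)| <= C * `|psi (eigval R l)|) ->
  fcalc_dom Y psi f -> fcalc_dom Y phi f.
Proof.
move=> phipsi /fcalc_domE; set M := (X in (X < _)%E) => Moo; apply/fcalc_domE.
apply: (@le_lt_trans _ _ ((C ^+ 2)%:E * M)%E); last first.
  by rewrite lte_mul_pinfty// lee_fin sqr_ge0.
rewrite /M -nneseriesZl; last first.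
  by move=> l _; rewrite lee_fin; apply: sum_order_ge0 => m; exact: sqr_ge0.
apply: lee_nneseries => [l _ _|l _].
  by rewrite lee_fin; apply: sum_order_ge0 => m; exact: sqr_ge0.
rewrite -EFinM lee_fin /sum_order big_distrr/=; apply: ler_sum => k _.
rewrite !exprMn [leRHS]mulrA ler_wpM2r ?sqr_ge0//.
rewrite -exprMn -[leLHS]real_normK ?num_real// -[leRHS]real_normK ?num_real//.
rewrite ler_sqr ?nnegrE// normrM (le_trans (phipsi l))//.
by rewrite ler_wpM2r// ler_norm.
Qed.

Lemma fcalc_dom_bounded phi f (C : R) :
  (forall l, `|phi (eigval R l)| <= C) -> fcalc_dom Y phi f.
Proof.
move=> phiC; apply: (@fcalc_dom_le phi (fun=> 1) f C).
  by move=> l; rewrite normr1 mulr1.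
exists f; rewrite /is_fcalc (_ : (fun l m => 1 * _) = fun l m => inner f (Y l m)).
  exact: sh_complete.
by apply/funext => l; apply/funext => m; rewrite mul1r.
Qed.

Definition modal_energy l u1 u2 : R := sum_order l (fun m =>
  (Lambda_m (eigval R l) * inner u1 (Y l m)) ^+ 2 + inner u2 (Y l m) ^+ 2).

Lemma modal_energy_ge0 l u1 u2 : 0 <= modal_energy l u1 u2.
Proof. by apply: sum_order_ge0 => m; rewrite addr_ge0 ?sqr_ge0. Qed.

(** Outside the domain of Lambda the energy is infinite by definition and the
    series diverges by [fcalc_domE]. *)
Lemma energy_series u1 u2 :
  energy Y u1 u2 = (\sum_(0 <= l <oo) (2^-1 * modal_energy l u1 u2)%:E)%E.
Proof.
have so0 l (F : int -> R) : (0 <= (sum_order l (fun m => F m ^+ 2))%:E)%E.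
  by rewrite lee_fin; apply: sum_order_ge0 => m; exact: sqr_ge0.
under eq_eseriesr do rewrite EFinM.
rewrite nneseriesZl; last by move=> l _; rewrite lee_fin modal_energy_ge0.
rewrite (_ : (\sum_(0 <= l <oo) _)%E = (\sum_(0 <= l <oo) (sum_order l
    (fun m => (Lambda_m (eigval R l) * inner u1 (Y l m)) ^+ 2))%:E +
  (inner u2 u2)%:E)%E); last first.
  rewrite (parseval hY) -nneseriesD//; apply: eq_eseriesr => l _.
  by rewrite -EFinD /modal_energy /sum_order big_split.
rewrite /energy; case: ifPn => /asboolP udom.
  rewrite -(parseval_fcalc (fcalcP udom)) !sqr_hnorm addrC.
  by rewrite -EFinD -EFinM.
have -> : (\sum_(0 <= l <oo) (sum_order l
    (fun m => (Lambda_m (eigval R l) * inner u1 (Y l m)) ^+ 2))%:E = +oo)%E.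
  apply/eqP; apply: contra_notT udom => udom; apply/fcalc_domE.
  by rewrite ltey.
by rewrite addye// gt0_muley// lte_fin invr_gt0.
Qed.

End functional_calculus.

(** * Measurability of coefficients *)

Section coefficient_measurability.
Context (R : realType).
Notation H := (L2S R).
Implicit Types (f g : H).

Lemma hopen_inner_gt g (r : R) : hopen [set f : H | r < inner f g].
Proof.
move=> f /= rf; exists ((inner f g - r) / (hnorm g + 1)).
  by rewrite divr_gt0 ?subr_gt0// ltr_wpDl ?hnorm_ge0.
have g0 : 0 < hnorm g + 1 by rewrite ltr_wpDl ?hnorm_ge0.
move=> h; rewrite ltr_pdivlMr// => hf.
have H1 : `|inner (h - f) g| < inner f g - r.
  apply: le_lt_trans (cauchy_schwarz _ _) _; apply: le_lt_trans hf.
  by rewrite ler_wpM2l ?hnorm_ge0// lerDl.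
by move: H1; rewrite innerBl ltr_norml => /andP[+ _]; lra.
Qed.

(** Half-spaces {r < <f, g>} are open for the L^2 seminorm and rays generate the
    Borel sets of the line. *)
Lemma hborel_inner g (C : set R) : measurable C -> hborel [set f : H | C (inner f g)].
Proof.
have mE : @measurable _ (measurableTypeR R) = <<s (@RGenOInfty.G R) >>.
  exact: RGenOInfty.measurableE.
have [B0 BC BU] : sigma_algebra setT (@hborel R) by exact: smallest_sigma_algebra.
suff : <<s (@RGenOInfty.G R) >> `<=` [set C | hborel [set f : H | C (inner f g)]].
  by move=> + mC; apply; rewrite -mE.
apply: smallest_sub.
  split.
  - by rewrite /= (_ : [set f | _] = set0)//; apply/seteqP; split.
  - by move=> A mA; exact: (BC _ mA).
  - by move=> A mA; exact: (BU _ mA).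
move=> _ [r ->]; rewrite /= (_ : [set f | _] = [set f : H | r < inner f g]).
  by apply: sub_sigma_algebra; exact: hopen_inner_gt.
by apply/seteqP; split => f /=; rewrite in_itv/= andbT.
Qed.

End coefficient_measurability.

Section sub_sigma_algebra.
Context d (Omega : measurableType d) (R : realType).
Implicit Types (G : set (set Omega)) (X Y : Omega -> R).

(** Measurability for a smaller sigma-algebra G, phrased with the measurable
    space generated by G so that the closure lemmas for measurable real
    functions apply to it. *)
Definition sub_measurable G X : Prop :=
  measurable_fun setT (X : g_sigma_algebraType G -> R).

Lemma sub_measurableP G X : sigma_algebra setT G ->
  (sub_measurable G X <-> forall C : set R, measurable C -> G (X @^-1` C)).
Proof.
move=> sG; split=> [mX C mC|mX _ C mC].
  by have := mX measurableT _ mC; rewrite setTI /measurable/= sigma_algebra_id.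
by rewrite setTI; apply: sub_sigma_algebra; exact: mX.
Qed.

Lemma sub_measurable_measurable G X : G `<=` measurable ->
  sub_measurable G X -> measurable_fun setT X.
Proof.
move=> Gm mX _ C mC; have := mX measurableT _ mC; rewrite setTI.
by apply: smallest_sub => //; exact: sigma_algebra_measurable.
Qed.

Lemma sub_measurableS G G' X : G `<=` G' -> sub_measurable G X -> sub_measurable G' X.
Proof.
move=> GG' mX _ C mC; have := mX measurableT _ mC.
exact: sub_sigma_algebra2 GG' _.
Qed.

(** Only coefficients are ever tested: the measurability of a sum of H-valued
    random variables for the Borel sets of H is thus never at stake. *)
Lemma hmeasurable_inner G (Z : Omega -> L2S R) g : hmeasurable G Z ->
  sub_measurable G (fun w => inner (Z w) g).
Proof.
move=> mZ _ C mC; rewrite setTI; apply: sub_sigma_algebra.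
exact: (mZ _ (hborel_inner g mC)).
Qed.

End sub_sigma_algebra.

(** * Increments of the Levy process *)

Section levy_increments.
Context (R : realType) (d : measure_display) (Omega : measurableType d).
Variable P : probability Omega R.
Notation H := (L2S R).
Variables (F : R -> set (set Omega)) (Q : H -> H) (L : R -> Omega -> H).
Hypothesis hF : complete_filtration P F.
Hypothesis hL : Q_levy_process P F Q L.
Implicit Types (g h : H) (s t : R).

Definition increment s t g (w : Omega) : R := inner (L t w - L s w) g.

Lemma filtration_sigma t : 0 <= t -> sigma_algebra setT (F t).
Proof. by case: hF => H _ _ /H[]. Qed.

Lemma filtration_measurable t : 0 <= t -> F t `<=` measurable.
Proof. by case: hF => H _ _ /H[]. Qed.

Lemma filtration_homo s t : 0 <= s -> s <= t -> F s `<=` F t.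
Proof. by case: hF => _ H _; exact: H. Qed.

Lemma levy_coef_adapted t g : 0 <= t ->
  sub_measurable (F t) (fun w => inner (L t w) g).
Proof.
by move=> t0; apply: hmeasurable_inner; exact: (levy_adapted (Q_levy hL)).
Qed.

Lemma increment_adapted s t g : 0 <= s -> s <= t ->
  sub_measurable (F t) (increment s t g).
Proof.
move=> s0 st; rewrite (_ : increment s t g =
    fun w => inner (L t w) g - inner (L s w) g); last first.
  by apply/funext => w; rewrite /increment innerBl.
apply: measurable_funB; first by apply: levy_coef_adapted; exact: le_trans st.
apply: sub_measurableS (levy_coef_adapted g s0).
exact: filtration_homo.
Qed.

Lemma measurable_increment s t g : 0 <= s -> s <= t ->
  measurable_fun setT (increment s t g).
Proof.
move=> s0 st; apply: sub_measurable_measurable (increment_adapted g s0 st).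
exact: filtration_measurable (le_trans s0 st).
Qed.

Lemma levy_coef_Lfun t g : 0 <= t -> (fun w => inner (L t w) g) \in Lfun P 2%:E.
Proof.
move=> t0; apply/Lfun2P; split.
  apply: sub_measurable_measurable (levy_coef_adapted g t0).
  exact: filtration_measurable.
rewrite /sqint; under eq_integral do rewrite expr2.
by rewrite (Q_covariance hL)// ltry.
Qed.

(** By stationarity the coefficient of L t - L s has the law of that of
    L (t - s), whose second moment is given by the covariance. *)
Lemma sqint_increment s t g : 0 <= s -> s <= t ->
  sqint P setT (increment s t g) = ((t - s) * inner (Q g) g)%:E.
Proof.
move=> s0 st; have ts0 : 0 <= t - s by rewrite subr_ge0.
rewrite -(Q_covariance hL ts0 g g).
have [mL _] := (Lfun2P P _).1 (levy_coef_Lfun g ts0).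
pose X : {RV P >-> R} := mfun_Sub (mem_set (measurable_increment g s0 st)).
pose Y : {RV P >-> R} := mfun_Sub (mem_set mL).
have msq : measurable_fun setT (fun x : R => (x ^+ 2)%:E).
  by apply: measurable_sqr; exact: measurable_id.
transitivity (\int[distribution P X]_x (x ^+ 2)%:E)%E.
  by rewrite ge0_integral_distribution// => x; rewrite lee_fin sqr_ge0.
transitivity (\int[distribution P Y]_x (x ^+ 2)%:E)%E.
  apply: eq_measure_integral => C mC _.
  exact: (levy_stationary (Q_levy hL) s0 st (hborel_inner g mC)).
by rewrite ge0_integral_distribution// => x; rewrite lee_fin sqr_ge0.
Qed.

Lemma increment_Lfun s t g : 0 <= s -> s <= t -> increment s t g \in Lfun P 2%:E.
Proof.
move=> s0 st; apply/Lfun2P; split; first exact: measurable_increment.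
by rewrite sqint_increment// ltry.
Qed.

Lemma increment_mean0 s t g : 0 <= s -> s <= t ->
  (\int[P]_w (increment s t g w)%:E = 0)%E.
Proof.
move=> s0 st; have t0 := le_trans s0 st.
have i1 u : 0 <= u -> P.-integrable setT (EFin \o (fun w => inner (L u w) g)).
  move=> u0; apply/Lfun1_integrable/Lfun_subset12.
    by apply: fin_num_measure; exact: measurableT.
  exact: levy_coef_Lfun.
under eq_integral do rewrite /increment innerBl EFinB.
rewrite integralB//; [|exact: i1..].
by rewrite !(Q_mean0 hL)// sube0.
Qed.

(** Pythagoras: the increment is centred and independent of F s. *)
Lemma sqint_add_increment s t g (X : Omega -> R) : 0 <= s -> s <= t ->
  sub_measurable (F s) X -> (sqint P setT X < +oo)%E ->
  sqint P setT (fun w => X w + increment s t g w) =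
  (sqint P setT X + ((t - s) * inner (Q g) g)%:E)%E.
Proof.
move=> s0 st mX Xoo; rewrite -(sqint_increment g s0 st); apply: sqint_indep.
- apply/Lfun2P; split => //.
  by apply: sub_measurable_measurable mX; exact: filtration_measurable.
- exact: increment_Lfun.
- move=> A B mA mB.
  have FA : F s (X @^-1` A) by exact: (sub_measurableP X (filtration_sigma s0)).1.
  exact: (levy_indep (Q_levy hL) s0 st FA (hborel_inner g mB)).
- exact: increment_mean0.
Qed.

(** Induction on the number of steps; each partial sum is measurable at the time
    where the next increment starts. *)
Lemma sqint_step_sum (X : Omega -> R) (tau : nat -> R) (h : nat -> H) n :
  sub_measurable (F 0) X -> (sqint P setT X < +oo)%E ->
  tau 0%N = 0 -> {homo tau : i j / (i <= j)%N >-> i <= j} ->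
  let W n := fun w => X w + \sum_(k < n) increment (tau k) (tau k.+1) (h k) w in
  sub_measurable (F (tau n)) (W n) /\
  sqint P setT (W n) = (sqint P setT X +
    (\sum_(k < n) (tau k.+1 - tau k) * inner (Q (h k)) (h k))%:E)%E.
Proof.
move=> mX Xoo tau0 nd W; have tau_ge0 k : 0 <= tau k by rewrite -tau0 nd.
elim: n => [|n [mW EW]].
  have -> : W 0%N = X by apply/funext => w; rewrite /W big_ord0 addr0.
  by rewrite big_ord0 adde0 tau0.
have WS : W n.+1 = fun w => W n w + increment (tau n) (tau n.+1) (h n) w.
  by apply/funext => w; rewrite /W big_ord_recr/= addrA.
have st : tau n <= tau n.+1 by exact: nd.
rewrite WS; split.
  apply: measurable_funD; last exact: increment_adapted.
  by apply: sub_measurableS mW; exact: filtration_homo.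
rewrite sqint_add_increment//; last by rewrite EW lte_add_pinfty// ltry.
by rewrite EW big_ord_recr/= EFinD addeA.
Qed.

End levy_increments.

(** * Step functions of time *)

Section step_functions.
Context (R : realType).
Variables (tau : nat -> R) (N : nat).
Hypothesis tau_homo : {homo tau : i j / (i <= j)%N >-> i <= j}.

Definition cell k (s : R) : R := \1_(`]tau k, tau k.+1]%classic : set R) s.

(** Cells are disjoint, so at each time a combination of them has at most one
    term. *)
Lemma cell_cases s : (forall k : 'I_N, cell k s = 0) \/
  exists k0 : 'I_N, forall k : 'I_N, cell k s = (k == k0)%:R.
Proof.
have [[k0 sk0]|nk] := pselect (exists k0 : 'I_N, `]tau k0, tau k0.+1]%classic s).
  right; exists k0 => k; rewrite /cell indicE; congr (nat_of_bool _)%:R.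
  apply/idP/idP => [/set_mem|/eqP->]; last exact: mem_set.
  move: sk0; rewrite /= !in_itv/= => /andP[k0s sk0] /andP[ks sk].
  apply/eqP/val_inj/eqP; rewrite eqn_leq; apply/andP; split.
    rewrite leqNgt; apply/negP => /tau_homo; rewrite leNgt => /negP; apply.
    exact: lt_le_trans ks sk0.
  rewrite leqNgt; apply/negP => /tau_homo; rewrite leNgt => /negP; apply.
  exact: lt_le_trans k0s sk.
left=> k; rewrite /cell indicE memNset//.
by move=> sk; apply: nk; exists k.
Qed.

Lemma hnorm_step (v : nat -> L2S R) s :
  hnorm (\sum_(k < N) cell k s *: v k) = \sum_(k < N) cell k s * hnorm (v k).
Proof.
have [H|[k0 H]] := cell_cases s.
  rewrite !big1; first by rewrite /hnorm inner0l sqrtr0.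
    by move=> k _; rewrite H mul0r.
  by move=> k _; rewrite H scale0r.
rewrite (bigD1 k0)//= [in RHS](bigD1 k0)//= !big1 ?addr0.
- by rewrite H eqxx scale1r mul1r.
- by move=> k kk0; rewrite H (negbTE kk0) mul0r.
- by move=> k kk0; rewrite H (negbTE kk0) scale0r.
Qed.

Lemma sqr_step (x : nat -> R) s :
  (\sum_(k < N) cell k s * x k) ^+ 2 = \sum_(k < N) cell k s * x k ^+ 2.
Proof.
have [H|[k0 H]] := cell_cases s.
  by rewrite !big1 ?expr0n// => k _; rewrite H mul0r.
rewrite (bigD1 k0)//= [in RHS](bigD1 k0)//= !big1 ?addr0.
- by rewrite H eqxx !mul1r.
- by move=> k kk0; rewrite H (negbTE kk0) mul0r.
- by move=> k kk0; rewrite H (negbTE kk0) mul0r.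
Qed.

Lemma measurable_cell k (D : set R) : measurable_fun D (cell k).
Proof. by apply: measurable_funTS; exact: measurable_indic. Qed.

Lemma measurable_step (x : nat -> R) (D : set R) :
  measurable_fun D (fun s => \sum_(k < N) cell k s * x k).
Proof.
apply: measurable_sum => k; apply: measurable_funM => //; exact: measurable_cell.
Qed.

Lemma sqint_step (x : nat -> R) (t : R) : tau 0%N = 0 -> tau N = t ->
  sqint (@lebesgue_measure R) `[0, t] (fun s => \sum_(k < N) cell k s * x k) =
  (\sum_(k < N) (tau k.+1 - tau k) * x k ^+ 2)%:E.
Proof.
move=> tau0 tauN; rewrite /sqint.
under eq_integral do rewrite sqr_step -sumEFin.
rewrite ge0_integral_sum//; last 2 first.
- move=> k; apply/measurable_EFinP; apply: measurable_funM => //; exact: measurable_cell.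
- move=> k s _; rewrite lee_fin mulr_ge0 ?sqr_ge0// /cell indicE; exact: ler0n.
rewrite -sumEFin; apply: eq_bigr => k _.
under eq_integral do rewrite EFinM muleC.
rewrite ge0_integralZl_EFin ?sqr_ge0//; last 2 first.
- by move=> s _; rewrite lee_fin /cell indicE ler0n.
- by apply/measurable_EFinP; exact: measurable_cell.
rewrite integral_indic// setIidl; last first.
  move=> s /=; rewrite !in_itv/= => /andP[ks sk]; apply/andP; split.
    by apply: le_trans (ltW ks); rewrite -tau0 tau_homo.
  by apply: (le_trans sk); rewrite -tauN tau_homo.
rewrite [X in (_ * X)%E](lebesgue_measure_itv `]tau k, tau k.+1])/= lte_fin.
case: ltP => [_|kk]; first by rewrite -EFinB -EFinM mulrC.
rewrite (_ : tau k.+1 = tau k) ?subrr ?mul0r ?mule0//.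
by apply/eqP; rewrite eq_le kk/= tau_homo.
Qed.

End step_functions.

(** * The Ito isometry in one mode *)

Section ito_mode.
Context (R : realType) (d : measure_display) (Omega : measurableType d).
Variable P : probability Omega R.
Notation H := (L2S R).
Notation leb := (@lebesgue_measure R).
Variables (Y : nat -> int -> H) (F : R -> set (set Omega)).
Variables (Q : H -> H) (L : R -> Omega -> H).
Hypothesis hY : real_spherical_harmonics Y.
Hypothesis hF : complete_filtration P F.
Hypothesis hL : Q_levy_process P F Q L.

Lemma inner_step_eval (p : step_process R) (s : R) (f y : H) (h : nat -> H) :
  (forall k f, inner (step_op p k f) y = inner f (h k)) ->
  inner (step_eval p s f) y =
  \sum_(k < step_size p) cell (step_time p) k s * inner f (h k).
Proof.
by move=> hP; rewrite inner_suml; apply: eq_bigr => k _; rewrite innerZl hP.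
Qed.

Lemma inner_step_integral (p : step_process R) w (y : H) (h : nat -> H) :
  (forall k f, inner (step_op p k f) y = inner f (h k)) ->
  inner (step_integral p L w) y = \sum_(k < step_size p)
    increment L (step_time p k) (step_time p k.+1) (h k) w.
Proof. by move=> hP; rewrite inner_suml; apply: eq_bigr => k _; rewrite hP. Qed.

(** The hypothesis says that z is the adjoint of T applied to y; Parseval for z
    and |<T f, y>| <= |T f| bound its norm by the Hilbert-Schmidt norm of T. *)
Lemma hs_norm2_lower (T : H -> H) (y z : H) : inner y y = 1 ->
  (forall l (k : 'I_(l.*2.+1)), inner (T (Y l (k%:Z - l%:Z))) y =
     inner (Y l (k%:Z - l%:Z)) z) ->
  ((hnorm z ^+ 2)%:E <= hs_norm2 Y T)%E.
Proof.
move=> y1 Tz; rewrite sqr_hnorm (parseval hY); apply: lee_nneseries => [l _ _|l _].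
  by rewrite lee_fin; apply: sum_order_ge0 => m; exact: sqr_ge0.
rewrite lee_fin; apply: ler_sum => k _; rewrite innerC -Tz sqr_hnorm.
by apply: le_trans (inner_sqr_le _ _) _; rewrite y1 mulr1.
Qed.

(** Reverse triangle inequality: it turns the convergence of H-valued integrands
    into that of real functions of time. *)
Lemma sqr_hnorm_diff_le (v z : H) (c : R) :
  (hnorm v - `|c| * hnorm z) ^+ 2 <= hnorm (v - c *: z) ^+ 2.
Proof.
rewrite sqr_hnorm innerBl !innerBr !innerZl !innerZr (innerC z v) -!sqr_hnorm.
have H1 : c * inner v z <= `|c| * (hnorm v * hnorm z).
  apply: le_trans (ler_norm _) _; rewrite normrM ler_wpM2l//.
  exact: cauchy_schwarz.
have cc : `|c| ^+ 2 = c ^+ 2 by rewrite real_normK ?num_real.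
rewrite sqrrB exprMn cc; move: H1; set a := `|c|; set x := hnorm v; set w := hnorm z.
by move=> H1; lra.
Qed.

Lemma op_sqrt_quad (S : H -> H) g : op_sqrt Q S ->
  hnorm (S g) ^+ 2 = inner (Q g) g.
Proof.
by case=> _ symS _ SS; rewrite sqr_hnorm -symS (ae_inner _ (SS g)).
Qed.

(** The limit of the second moment of X_n = X + <step integral n, y> is computed
    in two ways.  As X_n converges in L^2(P), it is the second moment of
    X + <I, y>.  By [sqint_step_sum], E X_n^2 is also E X^2 plus the integral of
    a_n^2, where a_n(s) = |S h| on each cell, and a_n tends in L^2(0, t) to
    c(s) = |phi_s(x)| |S y| by the Hilbert-Schmidt hypothesis. *)
Lemma ito_mode (phi : R -> R -> R) (t : R) (I : Omega -> H) (X : Omega -> R)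
    l (k : 'I_(l.*2.+1)) : 0 <= t ->
  is_stoch_integral P Y Q L t (fun s => fcalc Y (phi s)) I ->
  (forall s f, fcalc_dom Y (phi s) f) ->
  measurable_fun setT (fun s => phi s (eigval R l)) ->
  sub_measurable (F 0) X -> (sqint P setT X < +oo)%E ->
  let y := Y l (k%:Z - l%:Z) in
  sqint P setT (fun w => X w + inner (I w) y) =
  (sqint P setT X + (inner (Q y) y)%:E *
    sqint leb `[0%R, t] (fun s => phi s (eigval R l)))%E.
Proof.
move=> t0 [mI [S [hS [p [wf hs0 I0]]]]] dom mphi mX Xoo y.
have y1 : inner y y = 1 by rewrite inner_harmonics// !eqxx.
have symS : symmetric_op S by case: hS.
have /choice[h hP] n : exists h : nat -> H,
    forall k f, inner (step_op (p n) k f) y = inner f (h k).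
  have /choice[h hP] j : exists g, forall f, inner (step_op (p n) j f) y = inner f g.
    by apply: (adjoint_exists hY); case: (wf n).
  by exists h.
have tau0 n : step_time (p n) 0 = 0 by case: (wf n).
have tauT n : step_time (p n) (step_size (p n)) = t by case: (wf n).
have tauH n : {homo step_time (p n) : i j / (i <= j)%N >-> i <= j}.
  by case: (wf n).
pose a n s : R := \sum_(j < step_size (p n)) cell (step_time (p n)) j s *
  hnorm (S (h n j)).
pose c s : R := `|phi s (eigval R l)| * hnorm (S y).
pose X_ n w : R := X w + inner (step_integral (p n) L w) y.
have XE n : X_ n = (fun w => X w + \sum_(j < step_size (p n))
    increment L (step_time (p n) j) (step_time (p n) j.+1) (h n j) w).
  by apply/funext => w; rewrite /X_ (inner_step_integral _ (hP n)).
have mXn n : measurable_fun setT (X_ n).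
  rewrite XE; have [+ _] := @sqint_step_sum _ _ _ _ _ _ _ hF hL X _ (h n)
    (step_size (p n)) mX Xoo (tau0 n) (tauH n).
  apply: sub_measurable_measurable; rewrite tauT.
  exact: filtration_measurable hF _ _.
have EXn n : sqint P setT (X_ n) = (sqint P setT X + sqint leb `[0%R, t] (a n))%E.
  rewrite XE; have [_ ->] := @sqint_step_sum _ _ _ _ _ _ _ hF hL X _ (h n)
    (step_size (p n)) mX Xoo (tau0 n) (tauH n).
  congr (_ + _)%E; rewrite (sqint_step (tauH n) (fun j => hnorm (S (h n j))))//.
  by congr (_%:E); apply: eq_bigr => j _; rewrite (op_sqrt_quad _ hS).
have aoo n : (sqint leb `[0%R, t] (a n) < +oo)%E.
  by rewrite (sqint_step (tauH n) (fun j => hnorm (S (h n j))))// ltry.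
have F0m : F 0 `<=` measurable by exact: filtration_measurable hF _ _.
have mXI : measurable_fun setT (fun w => X w + inner (I w) y).
  apply: measurable_funD; first exact: sub_measurable_measurable mX.
  apply: (sub_measurable_measurable (G := measurable)) => //.
  exact: hmeasurable_inner.
have lim1 : sqint P setT (X_ n) @[n --> \oo] -->
    sqint P setT (fun w => X w + inner (I w) y).
  apply: cvg_sqint => //.
    by move=> n; rewrite EXn lte_add_pinfty.
  apply: (@squeeze_cvge _ _ _ _ (cst 0%E) _ _ _ _ _ I0); last exact: cvg_cst.
  apply: nearW => n; rewrite sqint_ge0/=; apply: le_integral_nonmeasurable => w _.
    by rewrite lee_fin sqr_ge0.
  rewrite lee_fin /X_ sqr_hnorm (_ : _ - _ = inner (step_integral (p n) L w - I w) y).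
    by apply: le_trans (inner_sqr_le _ _) _; rewrite y1 mulr1.
  by rewrite innerBl; ring.
have lim2 : sqint leb `[0%R, t] (a n) @[n --> \oo] --> sqint leb `[0%R, t] c.
  apply: cvg_sqint => //.
  - by move=> n; exact: (measurable_step _ _ (fun j => hnorm (S (h n j)))).
  - apply: measurable_funTS; apply: measurable_funM => //.
    exact: measurableT_comp.
  apply: (@squeeze_cvge _ _ _ _ (cst 0%E) _ _ _ _ _ hs0); last exact: cvg_cst.
  apply: nearW => n; rewrite sqint_ge0/=; apply: le_integral_nonmeasurable => s _.
    by rewrite lee_fin sqr_ge0.
  rewrite /a /c -(@hnorm_step _ _ _ (tauH n) (fun j => S (h n j))).
  set v := \sum_(j < _) (_ *: _).
  apply: (@le_trans _ _ (hnorm (v - phi s (eigval R l) *: S y) ^+ 2)%:E).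
    by rewrite lee_fin sqr_hnorm_diff_le.
  apply: hs_norm2_lower y1 _ => l' k'.
  rewrite innerBl (inner_step_eval _ _ (hP n)) inner_fcalc// innerBr innerZr.
  rewrite -symS; congr (_ - _); rewrite inner_sumr; apply: eq_bigr => j _.
  by rewrite innerZr symS.
have EQ : sqint leb `[0%R, t] c =
    ((inner (Q y) y)%:E * sqint leb `[0%R, t] (fun s => phi s (eigval R l)))%E.
  rewrite -(op_sqrt_quad y hS) -sqintZ//; last exact: measurable_funTS.
  apply: eq_integral => s _; rewrite /c !exprMn real_normK ?num_real//.
  by rewrite mulrC.
rewrite -EQ -(cvg_lim _ lim1)//; apply/cvg_lim => //.
rewrite (_ : (fun n => sqint P setT (X_ n)) = (fun n =>
  sqint P setT X + sqint leb `[0%R, t] (a n))%E); last exact/funext.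
apply: cvgeD => //; last exact: cvg_cst.
by apply: ge0_adde_def; rewrite inE; exact: sqint_ge0.
Qed.

End ito_mode.

(** * Wave multipliers and sums over the modes *)

Section multipliers.
Context (R : realType).
Implicit Types (t x a b : R).

Lemma cos_m_bound t x : `|cos_m t x| <= 1.
Proof. by rewrite ler_norml cos_geN1 cos_le1. Qed.

Lemma sin_bound x : `|sin x| <= 1.
Proof. by rewrite ler_norml sin_geN1 sin_le1. Qed.

(** For l > 0 the eigenvalue is at least 1; for l = 0 the multiplier is t. *)
Lemma sinc_m_bound t l : `|sinc_m t (eigval R l)| <= 1 + `|t|.
Proof.
rewrite /sinc_m; case: eqVneq => [_|l0]; first by rewrite lerDr.
rewrite normrM -[leRHS]mulr1; apply: ler_pM => //.
  by rewrite (le_trans (sin_bound _))// lerDl.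
have l1 : 1 <= eigval R l.
  by rewrite /eigval ler1n lt0n; apply: contra_neq l0 => l0; rewrite /eigval l0.
rewrite ger0_norm ?invr_ge0 ?sqrtr_ge0// invf_le1 ?sqrtr_gt0.
  by rewrite -sqrtr1 ler_sqrt// (le_trans _ l1).
exact: lt_le_trans l1.
Qed.

Lemma msin_m_bound t x : `|msin_m t x| <= 1 * `|Lambda_m x|.
Proof.
rewrite mul1r /msin_m normrM normrN ler_piMr//; exact: sin_bound.
Qed.

(** Multiplication by Lambda removes the case distinction at the zero
    eigenvalue. *)
Lemma Lambda_sinc t x : 0 <= x -> Lambda_m x * sinc_m t x = sin (t * Num.sqrt x).
Proof.
rewrite /Lambda_m /sinc_m le_eqVlt => /predU1P[<-|x0].
  by rewrite eqxx sqrtr0 mul0r mulr0 sin0.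
by rewrite gt_eqF// mulrC divfK// gt_eqF// sqrtr_gt0.
Qed.

Lemma eigval_ge0 l : 0 <= eigval R l.
Proof. exact: ler0n. Qed.

Lemma wave_rotation t x a b : 0 <= x ->
  (Lambda_m x * (cos_m t x * a + sinc_m t x * b)) ^+ 2 +
  (msin_m t x * a + cos_m t x * b) ^+ 2 = (Lambda_m x * a) ^+ 2 + b ^+ 2.
Proof.
move=> x0; rewrite mulrDr (mulrA _ (sinc_m t x)) Lambda_sinc//.
rewrite /cos_m /msin_m /Lambda_m; have := cos2Dsin2 (t * Num.sqrt x).
set s := sin _; set c := cos _; set y := Num.sqrt x => cs.
by rewrite -[RHS]mul1r -cs; ring.
Qed.

Lemma wave_kernel t x : 0 <= x ->
  (Lambda_m x * sinc_m t x) ^+ 2 + cos_m t x ^+ 2 = 1.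
Proof. by move=> x0; rewrite Lambda_sinc// addrC cos2Dsin2. Qed.

Lemma measurable_cos_m t x : measurable_fun setT (fun s : R => cos_m (t - s) x).
Proof.
apply: (@measurableT_comp _ _ _ _ _ _ (@cos R)).
  by apply: continuous_measurable_fun; exact: continuous_cos.
by apply: measurable_funM => //; exact: measurable_funB.
Qed.

Lemma measurable_sinc_m t x : measurable_fun setT (fun s : R => sinc_m (t - s) x).
Proof.
rewrite /sinc_m; case: (x == 0); first exact: measurable_funB.
apply: measurable_funM => //; apply: (@measurableT_comp _ _ _ _ _ _ (@sin R)).
  by apply: continuous_measurable_fun; exact: continuous_sin.
by apply: measurable_funM => //; exact: measurable_funB.
Qed.

End multipliers.

Section square_integral_sums.
Context d (T : measurableType d) (R : realType) (mu : {measure set T -> \bar R}).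

Lemma sqintD (D : set T) (f g : T -> R) : measurable D ->
  measurable_fun D f -> measurable_fun D g ->
  (sqint mu D f + sqint mu D g = \int[mu]_(x in D) (f x ^+ 2 + g x ^+ 2)%:E)%E.
Proof.
move=> mD mf mg; rewrite /sqint -ge0_integralD//.
- by move=> x _; rewrite lee_fin sqr_ge0.
- exact: measurable_sqr.
- by move=> x _; rewrite lee_fin sqr_ge0.
- exact: measurable_sqr.
Qed.

Lemma Lfun2_lin (A B : T -> R) (c e : R) : A \in Lfun mu 2%:E ->
  B \in Lfun mu 2%:E -> (fun x => c * A x + e * B x) \in Lfun mu 2%:E.
Proof.
move=> A2 B2; pose A' := Lfun_Sub (lee1n 2) A2; pose B' := Lfun_Sub (lee1n 2) B2.
exact: (LfunP (c *: A' + e *: B')).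
Qed.

(** For A = Lambda <u1, Y> and B = <u2, Y> this is the energy, by
    [energy_series]. *)
Definition modal_series (A B : nat -> int -> T -> R) (w : T) : \bar R :=
  (\sum_(0 <= l <oo)
     (2^-1 * sum_order l (fun m => A l m w ^+ 2 + B l m w ^+ 2))%:E)%E.

Section modal_series.
Variables A B : nat -> int -> T -> R.
Hypothesis mA : forall l m, measurable_fun setT (A l m).
Hypothesis mB : forall l m, measurable_fun setT (B l m).

Let measurable_term l : measurable_fun setT (fun w =>
  (2^-1 * sum_order l (fun m => A l m w ^+ 2 + B l m w ^+ 2))%:E).
Proof.
apply/measurable_EFinP; apply: measurable_funM => //.
by apply: measurable_sum => k; apply: measurable_funD; exact: measurable_funX.
Qed.

Let term_ge0 l w :
  (0 <= (2^-1 * sum_order l (fun m => A l m w ^+ 2 + B l m w ^+ 2))%:E)%E.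
Proof.
rewrite lee_fin mulr_ge0// ?invr_ge0//; apply: sum_order_ge0 => m.
by rewrite addr_ge0 ?sqr_ge0.
Qed.

Lemma measurable_modal_series : measurable_fun setT (modal_series A B).
Proof. exact: ge0_emeasurable_sum. Qed.

Lemma integral_modal_series :
  (\int[mu]_w modal_series A B w =
   \sum_(0 <= l <oo) (2^-1%:E * \sum_(k < l.*2.+1)
     (sqint mu setT (A l (k%:Z - l%:Z)%R) + sqint mu setT (B l (k%:Z - l%:Z)%R))))%E.
Proof.
rewrite /modal_series integral_nneseries//; apply: eq_eseriesr => l _.
have mterm k : measurable_fun setT (fun w => (A l k w ^+ 2 + B l k w ^+ 2)%:E).
  by apply/measurable_EFinP; apply: measurable_funD; exact: measurable_funX.
have pos k w : (0 <= (A l k w ^+ 2 + B l k w ^+ 2)%:E)%E.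
  by rewrite lee_fin addr_ge0 ?sqr_ge0.
under eq_integral do rewrite EFinM /sum_order -sumEFin.
rewrite ge0_integralZl_EFin ?invr_ge0//; last 2 first.
- by move=> w _; exact: sume_ge0.
- exact: emeasurable_sum.
congr (_ * _)%E; rewrite ge0_integral_sum//; apply: eq_bigr => k _.
by rewrite sqintD.
Qed.

End modal_series.

End square_integral_sums.

Section complete_measure.
Context d (T : measurableType d) (R : realType) (mu : {measure set T -> \bar R}).

(** A complete measure makes functions measurable when they agree almost
    everywhere with a measurable one; the energy of the solution is only known
    through such a representative. *)
Lemma ae_measurable_complete (f g : T -> \bar R) :
  mu.-negligible `<=` measurable -> measurable_fun setT g ->
  {ae mu, forall x, f x = g x} -> measurable_fun setT f.
Proof.
move=> compl mg [N [mN N0 NP]] _ C mC; rewrite setTI.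
have negN A : A `<=` N -> measurable A by move=> AN; apply: compl; exists N.
have -> : f @^-1` C = (g @^-1` C `\` N) `|` (f @^-1` C `&` N).
  apply/seteqP; split => x /=.
    move=> Cfx; have [Nx|nNx] := pselect (N x); [by right|left; split=> //].
    have -> // : g x = f x.
    by apply/eqP; apply: contra_notT nNx => /eqP gf; apply: NP => /= /esym.
  move=> [[Cgx nNx]|[]//]; have -> // : f x = g x.
  by apply/eqP; apply: contra_notT nNx => /eqP gf; apply: NP.
apply: measurableU; last by apply: negN => x [].
apply: measurableD => //; rewrite -[X in measurable X]setTI; exact: mg.
Qed.

Lemma ae_integral_complete (f g : T -> \bar R) :
  mu.-negligible `<=` measurable -> measurable_fun setT g ->
  {ae mu, forall x, f x = g x} -> (\int[mu]_x f x = \int[mu]_x g x)%E.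
Proof.
move=> compl mg fg; apply: ae_eq_integral => //.
  exact: ae_measurable_complete fg.
by apply: filterS fg => x fgx _.
Qed.

End complete_measure.

(** * Energy balance of one mode *)

Section wave_energy.
Context (R : realType) (d : measure_display) (Omega : measurableType d).
Variable P : probability Omega R.
Notation H := (L2S R).
Notation leb := (@lebesgue_measure R).
Variables (Y : nat -> int -> H) (F : R -> set (set Omega)).
Variables (Q : H -> H) (L : R -> Omega -> H).
Hypothesis hY : real_spherical_harmonics Y.
Hypothesis hF : complete_filtration P F.
Hypothesis hL : Q_levy_process P F Q L.

Lemma integral_wave_kernel l t : 0 <= t ->
  (sqint leb `[0%R, t]
     (fun s => Lambda_m (eigval R l) * sinc_m (t - s) (eigval R l))%R +
   sqint leb `[0%R, t] (fun s => cos_m (t - s) (eigval R l))%R = t%:E)%E.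
Proof.
move=> t0; rewrite sqintD//; last 2 first.
- by apply: measurable_funTS; apply: measurable_funM => //; exact: measurable_sinc_m.
- by apply: measurable_funTS; exact: measurable_cos_m.
under eq_integral do rewrite wave_kernel ?eigval_ge0//.
rewrite integral_cst// mul1e.
rewrite [LHS](lebesgue_measure_itv `[0%R, t])/= lte_fin.
case: ltP => [_|t0']; first by rewrite oppr0 adde0.
by congr (_%:E); apply/eqP; rewrite eq_le t0 t0'.
Qed.

Lemma F0_measurable : F 0 `<=` measurable.
Proof. exact: (filtration_measurable hF). Qed.

(** The moment of Lambda a controls a only when x <> 0; when x = 0 the position
    coefficient is multiplied by zero and contributes nothing. *)
Lemma mode_energy (t : R) (I1 I2 : Omega -> H) (a b : Omega -> R)
    l (k : 'I_(l.*2.+1)) : 0 <= t ->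
  is_stoch_integral P Y Q L t (fun s => fcalc Y (sinc_m (t - s))) I1 ->
  is_stoch_integral P Y Q L t (fun s => fcalc Y (cos_m (t - s))) I2 ->
  sub_measurable (F 0) a -> sub_measurable (F 0) b ->
  let x := eigval R l in let y := Y l (k%:Z - l%:Z) in
  (sqint P setT (fun w => Lambda_m x * a w)%R < +oo)%E ->
  (sqint P setT b < +oo)%E ->
  (sqint P setT (fun w => Lambda_m x *
      (cos_m t x * a w + sinc_m t x * b w + inner (I1 w) y))%R +
   sqint P setT (fun w => msin_m t x * a w + cos_m t x * b w + inner (I2 w) y)%R =
   sqint P setT (fun w => Lambda_m x * a w)%R + sqint P setT b +
   (t * inner (Q y) y)%:E)%E.
Proof.
move=> t0 hI1 hI2 ma mb x y aoo boo.
have x0 : 0 <= x by exact: eigval_ge0.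
have mF0 (X : Omega -> R) : sub_measurable (F 0) X -> measurable_fun setT X.
  exact: sub_measurable_measurable F0_measurable.
have ma' := mF0 _ ma; have mb' := mF0 _ mb.
have b2 : b \in Lfun P 2%:E by apply/Lfun2P.
have La2 : (fun w => Lambda_m x * a w) \in Lfun P 2%:E.
  by apply/Lfun2P; split=> //; exact: measurable_funM.
have mlin c e : sub_measurable (F 0) (fun w => c * a w + e * b w).
  by apply: measurable_funD; exact: measurable_funM.
have E2 : sqint P setT (fun w => msin_m t x * a w + cos_m t x * b w + inner (I2 w) y) =
    (sqint P setT (fun w => msin_m t x * a w + cos_m t x * b w)%R +
     (inner (Q y) y)%:E * sqint leb `[0%R, t] (fun s => cos_m (t - s) x)%R)%E.
  have := @ito_mode _ _ _ _ _ _ _ _ hY hF hL (fun s => cos_m (t - s)) t I2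
    (fun w => msin_m t x * a w + cos_m t x * b w) l k t0 hI2; apply => //.
  - by move=> s f; apply: (fcalc_dom_bounded hY) => l'; exact: cos_m_bound.
  - exact: measurable_cos_m.
  have /Lfun2P[_] // : (fun w => msin_m t x * a w + cos_m t x * b w) \in Lfun P 2%:E.
  rewrite (_ : (fun w => _) = fun w =>
     - sin (t * Num.sqrt x) * (Lambda_m x * a w) + cos_m t x * b w); last first.
    by apply/funext => w; rewrite /msin_m /Lambda_m; ring.
  exact: Lfun2_lin.
have E1 : sqint P setT (fun w => Lambda_m x *
      (cos_m t x * a w + sinc_m t x * b w + inner (I1 w) y)) =
    (sqint P setT (fun w => Lambda_m x * (cos_m t x * a w + sinc_m t x * b w))%R +
     (inner (Q y) y)%:E *
     sqint leb `[0%R, t] (fun s => Lambda_m x * sinc_m (t - s) x)%R)%E.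
  have mI1 : measurable_fun setT (fun w => inner (I1 w) y).
    apply: (sub_measurable_measurable (G := measurable)) => //.
    by apply: hmeasurable_inner; case: hI1.
  have mlin' : measurable_fun setT (fun w => cos_m t x * a w + sinc_m t x * b w).
    exact: mF0.
  rewrite !sqintZ//; last 2 first.
  - by apply: measurable_funTS; exact: measurable_sinc_m.
  - exact: measurable_funD.
  have [Lx0|Lx0] := eqVneq (Lambda_m x) 0.
    by rewrite Lx0 expr0n/= !mul0e mule0 adde0.
  have := @ito_mode _ _ _ _ _ _ _ _ hY hF hL (fun s => sinc_m (t - s)) t I1
    (fun w => cos_m t x * a w + sinc_m t x * b w) l k t0 hI1.
  rewrite -/x -/y => -> //.
  - rewrite ge0_muleDr ?sqint_ge0//; first by rewrite muleCA.
    by rewrite mule_ge0 ?sqint_ge0// lee_fin; exact: (Q_positive hL).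
  - by move=> s f; apply: (fcalc_dom_bounded hY) => l'; exact: sinc_m_bound.
  - exact: measurable_sinc_m.
  have /Lfun2P[_] // : (fun w => cos_m t x * a w + sinc_m t x * b w) \in Lfun P 2%:E.
  rewrite (_ : (fun w => _) = fun w =>
     cos_m t x / Lambda_m x * (Lambda_m x * a w) + sinc_m t x * b w); last first.
    by apply/funext => w; rewrite mulrA divfK.
  exact: Lfun2_lin.
rewrite E1 E2 addeACA; congr (_ + _)%E.
  have mLX : measurable_fun setT
      (fun w => Lambda_m x * (cos_m t x * a w + sinc_m t x * b w)).
    by apply: measurable_funM => //; exact: mF0.
  rewrite !sqintD//; [|exact: mF0|exact: measurable_funM].
  by apply: eq_integral => w _; rewrite wave_rotation.
rewrite -ge0_muleDr ?sqint_ge0// integral_wave_kernel// -EFinM mulrC.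
by [].
Qed.

(** With X = 0 and t = 0 the isometry gives a zero second moment. *)
Lemma stoch_integral_at0 (phi : R -> R -> R) (I : Omega -> H)
    l (k : 'I_(l.*2.+1)) :
  is_stoch_integral P Y Q L 0 (fun s => fcalc Y (phi s)) I ->
  (forall s f, fcalc_dom Y (phi s) f) ->
  measurable_fun setT (fun s => phi s (eigval R l)) ->
  {ae P, forall w, inner (I w) (Y l (k%:Z - l%:Z)) = 0}.
Proof.
move=> hI dom mphi; set y := Y l _.
have mI : measurable_fun setT (fun w => inner (I w) y).
  apply: (sub_measurable_measurable (G := measurable)) => //.
  by apply: hmeasurable_inner; case: hI.
have X0 : sqint P setT (fun=> 0 : R) = 0%E.
  by rewrite /sqint; apply: integral0_eq => w _; rewrite expr0n.
have := @ito_mode _ _ _ _ _ _ _ _ hY hF hL phi 0 I (fun=> 0) l k (lexx _) hI dom mphi.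
rewrite X0 => /(_ (measurable_cst _) (ltry _)) /=.
rewrite [X in (_ * X)%E](_ : _ = 0%E) ?mule0 ?adde0; last first.
  by rewrite /sqint set_itv1 integral_set1.
move=> I0.
have : ae_eq P setT (fun w => (inner (I w) y ^+ 2)%:E) (cst 0%E).
  apply/ae_eq_integral_abs => //; first exact: measurable_sqr.
  rewrite -[RHS]I0; apply: eq_integral => w _; rewrite add0r gee0_abs//.
  by rewrite lee_fin sqr_ge0.
apply: filterS => w /= Iw; apply/eqP; rewrite -sqrf_eq0; apply/eqP.
by case: (Iw Logic.I).
Qed.

End wave_energy.

(** * Energy balance *)

Section energy_balance.
Context (R : realType) (d : measure_display) (Omega : measurableType d).
Variable P : probability Omega R.
Notation H := (L2S R).
Variables (Y : nat -> int -> H) (F : R -> set (set Omega)).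
Variables (Q : H -> H) (L : R -> Omega -> H).
Hypothesis hY : real_spherical_harmonics Y.
Hypothesis hF : complete_filtration P F.
Hypothesis hL : Q_levy_process P F Q L.
Variables (v1 v2 : Omega -> H) (u1 u2 : R -> Omega -> H).
Hypothesis hv1 : hmeasurable (F 0) v1.
Hypothesis hv2 : hmeasurable (F 0) v2.
Hypothesis hu : mild_solution P Y Q L v1 v2 u1 u2.

Let position0 l m w := Lambda_m (eigval R l) * inner (v1 w) (Y l m).
Let velocity0 l m w := inner (v2 w) (Y l m).

Let position t (I1 : Omega -> H) l m w := Lambda_m (eigval R l) *
  (cos_m t (eigval R l) * inner (v1 w) (Y l m) +
   sinc_m t (eigval R l) * inner (v2 w) (Y l m) + inner (I1 w) (Y l m)).
Let velocity t (I2 : Omega -> H) l m w :=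
  msin_m t (eigval R l) * inner (v1 w) (Y l m) +
  cos_m t (eigval R l) * inner (v2 w) (Y l m) + inner (I2 w) (Y l m).

Lemma negligible_measurable : P.-negligible `<=` measurable.
Proof. by case: hF => _ _ /subset_trans; apply; exact: (F0_measurable hF). Qed.

Let F0_coef (v : Omega -> H) g : hmeasurable (F 0) v ->
  measurable_fun setT (fun w => inner (v w) g).
Proof.
move=> mv; apply: sub_measurable_measurable (hmeasurable_inner g mv).
exact: (F0_measurable hF).
Qed.

Let Omega_coef (v : Omega -> H) g : hmeasurable measurable v ->
  measurable_fun setT (fun w => inner (v w) g).
Proof.
by move=> mv; apply: sub_measurable_measurable (hmeasurable_inner g mv).
Qed.

Let measurable_position0 l m : measurable_fun setT (position0 l m).
Proof. by apply: measurable_funM => //; exact: F0_coef. Qed.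

Let measurable_velocity0 l m : measurable_fun setT (velocity0 l m).
Proof. exact: F0_coef. Qed.

Let measurable_position t I1 l m : hmeasurable measurable I1 ->
  measurable_fun setT (position t I1 l m).
Proof.
move=> mI; apply: measurable_funM => //; apply: measurable_funD; last exact: Omega_coef.
by apply: measurable_funD; apply: measurable_funM => //; exact: F0_coef.
Qed.

Let measurable_velocity t I2 l m : hmeasurable measurable I2 ->
  measurable_fun setT (velocity t I2 l m).
Proof.
move=> mI; apply: measurable_funD; last exact: Omega_coef.
by apply: measurable_funD; apply: measurable_funM => //; exact: F0_coef.
Qed.

Lemma energy_initial w : energy Y (v1 w) (v2 w) = modal_series position0 velocity0 w.
Proof. exact: energy_series. Qed.

(** The functional calculus acts on coefficients only inside its domain, which
    is automatic for the bounded multipliers cos and sinc but not for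
    - Lambda sin. *)
Lemma energy_mild (t : R) : 0 <= t ->
  {ae P, forall w, fcalc_dom Y (msin_m t) (v1 w)} ->
  exists I1 I2, [/\
    is_stoch_integral P Y Q L t (fun s => fcalc Y (sinc_m (t - s))) I1,
    is_stoch_integral P Y Q L t (fun s => fcalc Y (cos_m (t - s))) I2 &
    {ae P, forall w, energy Y (u1 t w) (u2 t w) =
       modal_series (position t I1) (velocity t I2) w}].
Proof.
move=> t0 dom1; have [I1 [I2 [hI1 hI2 E1 E2]]] := hu t0.
exists I1, I2; split; [exact: hI1|exact: hI2|].
have cdm f : fcalc_dom Y (cos_m t) f.
  by apply: (fcalc_dom_bounded hY) => l'; exact: cos_m_bound.
have sdm f : fcalc_dom Y (sinc_m t) f.
  by apply: (fcalc_dom_bounded hY) => l'; exact: sinc_m_bound.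
apply: filterS3 dom1 E1 E2 => w dm E1 E2.
have D3 f g h y : inner (f + g + h : H) y = inner f y + inner g y + inner h y.
  by rewrite !innerDl.
have c1 l (k : 'I_(l.*2.+1)) : Lambda_m (eigval R l) *
    inner (u1 t w) (Y l (k%:Z - l%:Z)) = position t I1 l (k%:Z - l%:Z) w.
  rewrite (ae_inner _ E1) D3; congr (_ * (_ + _ + _)).
    exact: (inner_fcalc hY k (cdm (v1 w))).
  exact: (inner_fcalc hY k (sdm (v2 w))).
have c2 l (k : 'I_(l.*2.+1)) :
    inner (u2 t w) (Y l (k%:Z - l%:Z)) = velocity t I2 l (k%:Z - l%:Z) w.
  rewrite (ae_inner _ E2) D3; congr (_ + _ + _).
    exact: (inner_fcalc hY k dm).
  exact: (inner_fcalc hY k (cdm (v2 w))).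
rewrite (energy_series hY); apply: eq_eseriesr => l _; congr (_ * _)%:E.
by apply: eq_bigr => k _; rewrite c1 c2.
Qed.

Lemma energy_at0 :
  {ae P, forall w, energy Y (u1 0 w) (u2 0 w) = energy Y (v1 w) (v2 w)}.
Proof.
have [|I1 [I2 [hI1 hI2 Eu]]] := @energy_mild 0 (lexx _).
  apply: aeW => w; apply: (@fcalc_dom_bounded _ _ hY _ _ 0) => l.
  by rewrite /msin_m mul0r sin0 mulr0 normr0.
have z1 : {ae P, forall w l (k : 'I_(l.*2.+1)), inner (I1 w) (Y l (k%:Z - l%:Z)) = 0}.
  apply: ae_foralln => l; apply: filter_forall => k.
  apply: (stoch_integral_at0 hY hF hL k hI1).
    by move=> s f; apply: (fcalc_dom_bounded hY) => l'; exact: sinc_m_bound.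
  exact: measurable_sinc_m.
have z2 : {ae P, forall w l (k : 'I_(l.*2.+1)), inner (I2 w) (Y l (k%:Z - l%:Z)) = 0}.
  apply: ae_foralln => l; apply: filter_forall => k.
  apply: (stoch_integral_at0 hY hF hL k hI2).
    by move=> s f; apply: (fcalc_dom_bounded hY) => l'; exact: cos_m_bound.
  exact: measurable_cos_m.
apply: filterS3 Eu z1 z2 => w -> z1 z2; rewrite energy_initial.
apply: eq_eseriesr => l _; congr (_ * _)%:E; apply: eq_bigr => k _.
rewrite /position /velocity z1 z2 !addr0 wave_rotation ?eigval_ge0//.
Qed.

Lemma integral_energy_at0 : (\int[P]_w energy Y (u1 0%R w) (u2 0%R w) =
  \int[P]_w modal_series position0 velocity0 w)%E.
Proof.
apply: (ae_integral_complete negligible_measurable).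
  exact: measurable_modal_series.
by apply: filterS energy_at0 => w ->; rewrite energy_initial.
Qed.

(** Finiteness of the initial expectation is used twice: mode by mode, as the
    moment condition of [mode_energy], and almost surely, to put v1 in the
    domain of Lambda. *)
Lemma energy_balance_modal (t : R) : 0 <= t ->
  (\int[P]_w modal_series position0 velocity0 w < +oo)%E ->
  (\int[P]_w energy Y (u1 t w) (u2 t w) =
   \int[P]_w modal_series position0 velocity0 w + (t / 2)%:E * trace Y Q)%E.
Proof.
move=> t0 E0oo.
have mS := measurable_modal_series measurable_position0 measurable_velocity0.
have S0 w : (0 <= modal_series position0 velocity0 w)%E.
  by rewrite -energy_initial (energy_series hY); apply: nneseries_ge0 => l _ _;
    rewrite lee_fin mulr_ge0 ?invr_ge0 ?modal_energy_ge0.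
have domL : {ae P, forall w, fcalc_dom Y (msin_m t) (v1 w)}.
  have iS : P.-integrable setT (modal_series position0 velocity0).
    by apply/integrableP; split => //; under eq_integral do rewrite gee0_abs//.
  have := integrable_ae measurableT iS; apply: filterS => w /(_ Logic.I).
  (* Outside the domain of Lambda the energy is infinite. *)
  rewrite -energy_initial /energy; case: ifPn => // /asboolP Ldom _.
  apply: (fcalc_dom_le hY _ Ldom) => l; exact: msin_m_bound.
have [I1 [I2 [hI1 hI2 Eu]]] := energy_mild t0 domL.
have mI1 : hmeasurable measurable I1 by case: hI1.
have mI2 : hmeasurable measurable I2 by case: hI2.
have mS' := measurable_modal_series (fun l m => measurable_position t l m mI1)
  (fun l m => measurable_velocity t l m mI2).
rewrite (ae_integral_complete negligible_measurable mS' Eu).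
rewrite (integral_modal_series P (fun l m => measurable_position t l m mI1)
  (fun l m => measurable_velocity t l m mI2)).
move: E0oo; rewrite (integral_modal_series P measurable_position0 measurable_velocity0).
pose s0 l (k : 'I_(l.*2.+1)) :=
  (sqint P setT (position0 l (k%:Z - l%:Z)%R) +
   sqint P setT (velocity0 l (k%:Z - l%:Z)%R))%E.
have s0_ge0 l k : (0 <= s0 l k)%E by rewrite adde_ge0// sqint_ge0.
pose m0 l := (2^-1%:E * \sum_(k < l.*2.+1) s0 l k)%E.
have m0_ge0 l : (0 <= m0 l)%E by rewrite mule_ge0 ?lee_fin ?invr_ge0// sume_ge0.
rewrite -/(\sum_(0 <= l <oo) m0 l)%E => E0oo.
have s0_fin l k : (s0 l k < +oo)%E.
  have m0oo : (m0 l < +oo)%E.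
    apply: le_lt_trans E0oo.
    apply: (@le_trans _ _ (\sum_(0 <= j < l.+1) m0 j)%E).
      by rewrite big_nat_recr//= leeDr// sume_ge0.
    by apply: nneseries_lim_ge => j _ _.
  have : (\sum_(k < l.*2.+1) s0 l k < +oo)%E.
    apply: contraTT m0oo; rewrite -!leNgt !leye_eq => /eqP; rewrite /m0 => ->.
    by rewrite gt0_muley// lte_fin invr_gt0.
  apply: le_lt_trans; rewrite (bigD1 k)//= leeDl// sume_ge0//.
pose q l : R := sum_order l (fun m => inner (Q (Y l m)) (Y l m)).
have q0 l : 0 <= q l by apply: sum_order_ge0 => m; exact: (Q_positive hL).
have -> : (\sum_(0 <= l <oo) (2^-1%:E * \sum_(k < l.*2.+1)
     (sqint P setT (position t I1 l (k%:Z - l%:Z)%R) +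
      sqint P setT (velocity t I2 l (k%:Z - l%:Z)%R))) =
   \sum_(0 <= l <oo) (m0 l + (t / 2)%:E * (q l)%:E))%E.
  apply: eq_eseriesr => l _.
  transitivity (2^-1%:E * \sum_(k < l.*2.+1) (s0 l k +
      (t * inner (Q (Y l (k%:Z - l%:Z)%R)) (Y l (k%:Z - l%:Z)%R))%:E))%E.
    congr (_ * _)%E; apply: eq_bigr => k _.
    have := s0_fin l k; rewrite /s0 => s0oo.
    apply: (mode_energy hY hF hL k t0 hI1 hI2).
    - exact: hmeasurable_inner.
    - exact: hmeasurable_inner.
    - by apply: le_lt_trans s0oo; rewrite leeDl// sqint_ge0.
    - by apply: le_lt_trans s0oo; rewrite leeDr// sqint_ge0.
  rewrite big_split/= sumEFin ge0_muleDr ?sume_ge0//; last first.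
    rewrite lee_fin; apply: sumr_ge0 => k _; rewrite mulr_ge0//.
    exact: (Q_positive hL).
  congr (_ + _)%E; rewrite -!EFinM -big_distrr/= mulrA (mulrC _ t).
  by [].
rewrite nneseriesD//; last first.
  by move=> l _ _; rewrite -EFinM lee_fin mulr_ge0// divr_ge0.
congr (_ + _)%E; rewrite nneseriesZl// => l _.
by rewrite lee_fin.
Qed.

End energy_balance.

Theorem proposition2 (R : realType) (d : measure_display)
  (Omega : measurableType d) (P : probability Omega R)
  (F : R -> set (set Omega)) (hF : complete_filtration P F)
  (Y : nat -> int -> L2S R) (hY : real_spherical_harmonics Y)
  (Q : L2S R -> L2S R) (L : R -> Omega -> L2S R)
  (hL : Q_levy_process P F Q L) (hQ : (trace Y Q < +oo)%E)
  (v1 v2 : Omega -> L2S R)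
  (hv1 : hmeasurable (F 0) v1) (hv2 : hmeasurable (F 0) v2)
  (u1 u2 : R -> Omega -> L2S R)
  (hu : mild_solution P Y Q L v1 v2 u1 u2)
  (hE0 : (\int[P]_w energy Y (u1 0%R w) (u2 0%R w) < +oo)%E)
  (t : R) (ht : 0 <= t) :
  (\int[P]_w energy Y (u1 t w) (u2 t w) =
   (\int[P]_w energy Y (u1 0%R w) (u2 0%R w)) + (t / 2)%:E * trace Y Q)%E.
Proof.
have E0 := integral_energy_at0 hY hF hL hv1 hv2 hu.
have E0oo := eq_ind _ (fun x => (x < +oo)%E) hE0 _ E0.
apply: etrans (energy_balance_modal hY hF hL hv1 hv2 hu ht E0oo) _.
exact (f_equal2 _ (esym E0) erefl).
Qed.
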